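(* Let $p<q$ be primes. Say that a $C_{pq}$-transfer system $\to$ is realized by a Steiner or linear isometries operad if there is a $C_{pq}$-universe $U$ such that $\to\ =\ \to_{\mathcal{K}(U)}$ or $\to\ =\ \to_{\mathcal{L}(U)}$. Let $\mathcal{T}_p$ (respectively $\mathcal{T}_q$) be the $C_{pq}$-transfer system whose only nontrivial relation is $C_1\to C_p$ (respectively $C_1\to C_q$). (1) If $p=2$ and $q=3$, then every $C_{pq}$-transfer system except $\mathcal{T}_p$ and $\mathcal{T}_q$ is realized by a Steiner or linear isometries operad, and $\mathcal{T}_p$ and $\mathcal{T}_q$ are not. (2) If $p=2$ or $3$ and $q>3$, then every $C_{pq}$-transfer system except $\mathcal{T}_q$ is realized by a Steiner or linear isometries operad, and $\mathcal{T}_q$ is not. (3) If $p,q>3$, then every $C_{pq}$-transfer system is realized by a Steiner or linear isometries operad.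
   Context: $C_m$ denotes the cyclic group of order $m$, and for $d\mid m$, $C_d\subset C_m$ is its unique subgroup of order $d$. Let $G$ be a finite group and $\mathrm{Sub}(G)$ its set of subgroups. A $G$-transfer system is a partial order $\to$ on $\mathrm{Sub}(G)$ such that: if $K\to H$ then $K\subset H$; if $K\to H$ then $gKg^{-1}\to gHg^{-1}$ for all $g\in G$; if $K\to H$ and $L\subset H$ then $K\cap L\to L$. A relation $K\to H$ is nontrivial if $K\neq H$. A $G$-universe is a countably infinite dimensional real inner product space $U$ with a linear isometric $G$-action, which contains each of its (finite dimensional) subrepresentations infinitely often, and which contains trivial summands. Linear isometries operad: $\mathcal{L}(U)(n)$ is the $G\times\Sigma_n$-space of all linear, not necessarily equivariant, isometries $U^{\oplus n}\hookrightarrow U$ ($G$ acts by conjugation, $\Sigma_n$ by permuting summands). Steiner operad: for a finite dimensional real orthogonal $G$-representation $V$, let $R_V$ be the $G$-space (under conjugation) of distance-reducing, not necessarily equivariant, embeddings $V\to V$. A $V$-Steiner path is a map $h:[0,1]\to R_V$ with $h(1)=\mathrm{id}$, and $\mathcal{K}(V)(n)$ is the $G\times\Sigma_n$-space of $n$-tuples $(h_1,\dots,h_n)$ of $V$-Steiner paths such that the images of $h_1(0),\dots,h_n(0)$ are disjoint. Set $\mathcal{K}(U)=\mathrm{colim}_{V\subset U}\mathcal{K}(V)$, over finite dimensional subrepresentations $V\subset U$ (for $V\subset W$ one takes the product with the identity on the orthogonal complement of $V$ in $W$). For $\mathcal{O}=\mathcal{K}(U)$ or $\mathcal{L}(U)$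 and $K\subset H\subset G$ with $n=|H:K|$, let $\Gamma(H/K)=\{(h,\sigma(h))\mid h\in H\}\subset G\times\Sigma_n$ be the graph of a permutation representation $\sigma:H\to\Sigma_n$ of $H/K$. The transfer system $\to_{\mathcal{O}}$ is defined by: $K\to_{\mathcal{O}}H$ iff $K\subset H$ and $\mathcal{O}(n)^{\Gamma(H/K)}\neq\varnothing$. By known theorems of Blumberg and Hill, for $K\subset H$: $K\to_{\mathcal{K}(U)}H$ iff there is an injective $H$-equivariant map of sets $H/K\hookrightarrow\mathrm{res}^G_HU$, and $K\to_{\mathcal{L}(U)}H$ iff there is an $H$-equivariant linear embedding $\mathrm{ind}_K^H\mathrm{res}^G_KU\hookrightarrow\mathrm{res}^G_HU$. *)

(* Defs.v *)
From HB Require Import structures.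
From mathcomp Require Import all_boot all_order all_algebra all_fingroup.
From mathcomp Require Import sesquilinear.
From mathcomp Require Import classical_sets reals topology normedtype.
From mathcomp Require Import function_spaces.

Set Implicit Arguments.
Unset Strict Implicit.
Unset Printing Implicit Defensive.

Import Order.TTheory GRing.Theory Num.Theory.
Import numFieldNormedType.Exports.

Local Open Scope classical_set_scope.
Local Open Scope ring_scope.

(* The finite group G is the whole finGroupType gT, so that Sub(G) is the
   type {group gT}. *)
Definition sub_rel (gT : finGroupType) := {group gT} -> {group gT} -> Prop.

Definition eq_sub_rel (gT : finGroupType) (T T' : sub_rel gT) : Prop :=
  forall K H, T K H <-> T' K H.

(* gKg^-1 is written K :^ g^-1, since A :^ x stands for x^-1 A x. *)
Record transfer_system (gT : finGroupType) (T : sub_rel gT) : Prop := {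
  ts_refl : forall K, T K K;
  ts_anti : forall K H, T K H -> T H K -> K = H;
  ts_trans : forall L K H, T L K -> T K H -> T L H;
  ts_sub : forall K H, T K H -> K \subset H;
  ts_conj : forall K H (g : gT), T K H -> T (K :^ g^-1)%G (H :^ g^-1)%G;
  ts_restr : forall K H (L : {group gT}),
    T K H -> L \subset H -> T (K :&: L)%G L
}.

(* In a cyclic group of order divisible by r, the only nontrivial relation is
   C_1 -> C_r. *)
Definition bottom_rel (gT : finGroupType) (r : nat) : sub_rel gT :=
  fun K H => K = H \/ (K = 1%G /\ #|H| = r).

Lemma bottom_rel_transfer_system (gT : finGroupType) (r : nat) :
  prime r -> transfer_system (@bottom_rel gT r).
Proof.
move=> r_pr; split.
- by move=> K; left.
- move=> K H [//|[-> cH]] [//|[H1 _]].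
  by move: r_pr; rewrite -cH H1 cards1.
- move=> L K H [->//|[-> cK]] [<-|[K1 _]]; first by right.
  by move: r_pr; rewrite -cK K1 cards1.
- by move=> K H [->//|[-> _]]; rewrite sub1G.
- move=> K H g [->|[-> cH]]; first by left.
  by right; split; [apply/val_inj; rewrite /= conjs1g | rewrite /= cardJg].
- move=> K H L [->|[-> cH]] sLH.
    by left; apply/val_inj; rewrite /=; apply/finset.setIidPr.
  have: (#|L| %| r)%N by rewrite -cH cardSg.
  have E1 : (1 :&: L)%G = 1%G :> {group gT}.
    by apply/val_inj; rewrite /=; apply/finset.setIidPl; rewrite sub1G.
  rewrite E1 => /(primeP r_pr).2 /orP[/eqP L1|/eqP]; last by right.
  by left; apply/val_inj/esym; rewrite /=; apply: card1_trivg.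
Qed.

(* A real inner product space with a linear isometric left action of gT. The
   normed module structure is the one induced by the inner product. *)
Record orthrep (R : realType) (gT : finGroupType) := OrthRep {
  rep_space :> normedModType R;
  dot : {dot rep_space for idfun};
  dot_norm : forall u, dot u u = `|u| ^+ 2;
  rep_act : gT -> {linear rep_space -> rep_space};
  rep_act1 : forall u, rep_act 1%g u = u;
  rep_actM : forall g h u, rep_act (g * h)%g u = rep_act g (rep_act h u);
  rep_act_isom : forall g u v, dot (rep_act g u) (rep_act g v) = dot u v
}.

Section Representations.
Variables (R : realType) (gT : finGroupType) (U : orthrep R gT).

Definition countably_infinite_dim : Prop :=
  exists e : nat -> U,
    (forall u, exists n (c : nat -> R), u = \sum_(i < n) c i *: e i) /\
    (forall n (c : nat -> R),
       \sum_(i < n) c i *: e i = 0 -> forall i, (i < n)%N -> c i = 0).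

Definition finite_dim_subspace (V : set U) : Prop :=
  exists n (b : 'I_n -> U),
    V = [set \sum_(i < n) c i *: b i | c in [set: 'I_n -> R]].

Definition fin_subrep (V : set U) : Prop :=
  finite_dim_subspace V /\ forall g v, V v -> V (rep_act U g v).

(* The orthogonal direct sum of countably many copies of V embeds
   equivariantly and isometrically: j k is the inclusion of the k-th copy. *)
Definition contains_infinitely_often (V : set U) : Prop :=
  exists j : nat -> U -> U,
    [/\ forall k a u v, V u -> V v -> j k (a *: u + v) = a *: j k u + j k v,
        forall k g v, V v -> j k (rep_act U g v) = rep_act U g (j k v),
        forall k u v, V u -> V v -> dot U (j k u) (j k v) = dot U u v
      & forall k l u v, k <> l -> V u -> V v -> dot U (j k u) (j l v) = 0].

Definition is_universe : Prop :=
  [/\ countably_infinite_dim,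
      forall V, fin_subrep V -> contains_infinitely_often V
    & exists2 u : U, u != 0 & forall g, rep_act U g u = u].

(* Linear isometries operad. Sigma_n permutes the summands of U^n by
   (s x)_(s i) = x_i, and (g, s) sends f to g f ((g, s)^-1 -). *)

Definition linear_isometry n (f : {linear {ffun 'I_n -> U} -> U}) : Prop :=
  forall x y, dot U (f x) (f y) = \sum_i dot U (x i) (y i).

Definition linisom_act n (a : gT * 'S_n) (f : {ffun 'I_n -> U} -> U) :
    {ffun 'I_n -> U} -> U :=
  fun x => rep_act U a.1 (f [ffun i => rep_act U a.1^-1%g (x (a.2 i))]).

Definition linisom_fixed n (Gamma : {set gT * 'S_n}) : Prop :=
  exists2 f : {linear {ffun 'I_n -> U} -> U}, linear_isometry f &
    forall a, a \in Gamma -> forall x, linisom_act a f x = f x.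

(* Steiner operad. A self-map of a subrepresentation V is represented by a
   function U -> U, of which only the values on V are relevant; likewise a path
   of such maps is a function on R, of which only the values on `[0, 1] are
   relevant. *)

Definition embedding_on (V : set U) (f : U -> U) : Prop :=
  {within V, continuous f} /\
  exists g : U -> U,
    (forall v, V v -> g (f v) = v) /\ {within f @` V, continuous g}.

Definition RV (V : set U) (f : U -> U) : Prop :=
  [/\ f @` V `<=` V, 1.-lipschitz_V f & embedding_on V f].

(* {family compactly_in V, U -> U} is the topology of uniform convergence on
   the compact subsets of V, that is, the compact-open topology on the
   restrictions to V. *)
Definition steiner_path (V : set U) (h : R -> U -> U) : Prop :=
  [/\ forall t, t \in `[0, 1] -> RV V (h t),
      {within `[0, 1], continuous (h : R -> {family compactly_in V, U -> U})}
    & forall v, V v -> h 1 v = v].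

Definition KV (V : set U) n (h : 'I_n -> R -> U -> U) : Prop :=
  (forall i, steiner_path V (h i)) /\
  (forall i j v w, i != j -> V v -> V w -> h i 0 v <> h j 0 w).

(* k is the image of h under the structure map K(V)(n) -> K(W)(n); every
   element of W is uniquely v + w with v in V and w in W orthogonal to V. *)
Definition KV_image (V W : set U) n (h k : 'I_n -> R -> U -> U) : Prop :=
  forall i t v w, t \in `[0, 1] -> V v -> W w ->
    (forall v', V v' -> dot U v' w = 0) -> k i t (v + w) = h i t v + w.

(* Elements (V, h) and (V', h') define the same point of the filtered colimit
   K(U)(n). *)
Definition KU_eq n (V : set U) (h : 'I_n -> R -> U -> U)
    (V' : set U) (h' : 'I_n -> R -> U -> U) : Prop :=
  exists (W : set U) (k : 'I_n -> R -> U -> U),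
    [/\ fin_subrep W, V `<=` W, V' `<=` W & KV W k] /\
    (KV_image V W h k /\ KV_image V' W h' k).

Definition KV_act n (a : gT * 'S_n) (h : 'I_n -> R -> U -> U) :
    'I_n -> R -> U -> U :=
  fun i t v => rep_act U a.1 (h (a.2^-1%g i) t (rep_act U a.1^-1%g v)).

Definition steiner_fixed n (Gamma : {set gT * 'S_n}) : Prop :=
  exists (V : set U) (h : 'I_n -> R -> U -> U),
    [/\ fin_subrep V, KV V h &
      forall a, a \in Gamma -> KU_eq V (KV_act a h) V h].

End Representations.

Section AssociatedTransferSystem.
Variable gT : finGroupType.

(* sigma restricted to H is a permutation representation of H/K: the left
   cosets of K in H are listed as c 0, ..., c (n - 1), and
   h (c i) = c (sigma h i). *)
Definition perm_rep (K H : {group gT}) n (sigma : gT -> 'S_n) : Prop :=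
  exists c : 'I_n -> {set gT},
    [/\ injective c, [set c i | i in 'I_n]%SET = lcosets K H &
      forall h, h \in H -> forall i, c (sigma h i) = (h *: c i)%g].

Definition graph_of (H : {group gT}) n (sigma : gT -> 'S_n) :
    {set gT * 'S_n} :=
  [set (h, sigma h) | h in H]%SET.

(* fixed n Gamma stands for: O(n)^Gamma is nonempty. *)
Definition operad_rel (fixed : forall n, {set gT * 'S_n} -> Prop) :
    sub_rel gT :=
  fun K H => K \subset H /\
    exists sigma : gT -> 'S_#|H : K|%g,
      perm_rep K H sigma /\ fixed _ (graph_of H sigma).

Definition linisom_rel (R : realType) (U : orthrep R gT) : sub_rel gT :=
  operad_rel (@linisom_fixed R gT U).

Definition steiner_rel (R : realType) (U : orthrep R gT) : sub_rel gT :=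
  operad_rel (@steiner_fixed R gT U).

Definition realized (R : realType) (T : sub_rel gT) : Prop :=
  exists2 U : orthrep R gT, is_universe U &
    eq_sub_rel T (steiner_rel U) \/ eq_sub_rel T (linisom_rel U).

End AssociatedTransferSystem.

(* Main.v *)
Require Import Defs.
From HB Require Import structures.
From mathcomp Require Import all_boot all_order all_algebra all_fingroup.
From mathcomp Require Import all_solvable.
From mathcomp Require Import ring lra.
From mathcomp Require Import sesquilinear.
From mathcomp Require Import boolp classical_sets reals topology normedtype.
From mathcomp Require Import function_spaces trigo.

(** Both operads are understood through what they require of the universe [U].

    Evaluating a fixed point of the Steiner operad at time 0 and at the origin
    gives points of [U] permuted by [H] as the cosets of [K], so a point with
    [H]-stabiliser [K]; conversely, contracting towards the orbit of such a
    point gives equivariant Steiner paths ([steiner_relP]). A fixed point of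
    the linear isometries operad is an [H]-equivariant isometry from the
    representation induced from [K] to [H] by [U], that is, a [K]-equivariant
    isometry [f] of [U] such that [H] moves its image off to orthogonal
    subspaces along the cosets of [K] ([linisom_relP]). For [K = 1], such an
    [f] exists as soon as [U] contains the regular representation of [H], in
    the form of one orthonormal orbit ([linisom_of_free_orbit]).

    Let [A] and [B] be the subgroups of order [p] and [q] of the cyclic group
    [G] of order [p q]. A transfer system is determined by which of [1 -> A],
    [1 -> B], [1 -> G], [A -> G], [B -> G] it contains
    ([eq_sub_rel_lattice]), and restriction and transitivity leave ten of them.
    A universe is determined by the set of characters of [G] that occur in it.

    Steiner operads realize the seven systems in which [1 -> A] only occurs
    with [1 -> G] or [B -> G], and [1 -> B] only with [1 -> G] or [A -> G]: put
    in [U] a faithful character if [1 -> G], a character with kernel [A] if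
    [A -> G], and one with kernel [B] if [B -> G] ([steiner_realized]).

    Three systems remain. That of [1 -> A] and [1 -> B] is realized by the
    linear isometries operad for the characters trivial on [A] or on [B]
    ([bottoms_realized]): [(x - 1) (y - 1)] vanishes on [U] for [x] in [A] and
    [y] in [B], so that [G] has no free orbit of independent vectors. That of
    [1 -> A] alone is realized, if [#|B| > 3], by the characters trivial on [B]
    and a faithful one ([bottom_realized]): then [B] has only three characters
    on [U], too few for its regular representation.

    When [A] has order 2 or 3, its nontrivial irreducible real representation
    and a trivial one add up to the regular representation
    ([small_order_free_orbit]). So if [U] realizes [1 -> B], either [A] acts
    nontrivially and [1 -> A] holds too, or [A] acts trivially and the map
    giving [1 -> B] also gives [A -> G]. Hence the system of [1 -> B] alone is
    not realized ([bottom_not_realized]). *)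

Set Implicit Arguments.
Unset Strict Implicit.
Unset Printing Implicit Defensive.

(** * Inner product representations *)

Section InnerProduct.
Import Order.TTheory GRing.Theory Num.Theory.
Import numFieldNormedType.Exports.
Local Open Scope ring_scope.
Variables (R : realType) (gT : finGroupType) (U : orthrep R gT).
Implicit Types (u v w : U) (g h : gT).

Lemma dotC u v : dot U u v = dot U v u.
Proof. by rewrite hermC /= expr0 mul1r. Qed.

Lemma dotZl a u v : dot U (a *: u) v = a * dot U u v.
Proof. by rewrite linearZl_LR. Qed.

Lemma dotZr a u v : dot U u (a *: v) = a * dot U u v.
Proof. by rewrite linearZr_LR. Qed.

Lemma dot_eq0 u : dot U u u = 0 -> u = 0.
Proof. by rewrite dot_norm => /eqP; rewrite expf_eq0 /= normr_eq0 => /eqP. Qed.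

Lemma dot_ge0 u : 0 <= dot U u u.
Proof. by rewrite dot_norm exprn_ge0. Qed.

Lemma rep_actK g u : rep_act U g^-1%g (rep_act U g u) = u.
Proof. by rewrite -rep_actM mulVg rep_act1. Qed.

Lemma rep_actKV g u : rep_act U g (rep_act U g^-1%g u) = u.
Proof. by rewrite -rep_actM mulgV rep_act1. Qed.

Lemma dot_act g u v : dot U (rep_act U g u) v = dot U u (rep_act U g^-1%g v).
Proof. by rewrite -[in LHS](rep_actKV g v) rep_act_isom. Qed.

Lemma norm_act g u : `|rep_act U g u| = `|u|.
Proof.
by apply/eqP; rewrite -(@eqrXn2 _ 2) // -!dot_norm rep_act_isom.
Qed.

End InnerProduct.

(** * Permutation representations on cosets *)

Section Cosets.
Variable gT : finGroupType.
Implicit Types (K H : {group gT}).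
Local Open Scope group_scope.

Lemma perm_rep_exists K H : K \subset H ->
  exists sigma : gT -> 'S_#|H : K|, perm_rep K H sigma.
Proof.
move=> sKH; have cN := card_lcosets H K.
have c_subproof (i : 'I_#|H : K|) : (i < #|lcosets K H|)%N by rewrite cN.
pose c i := enum_val (Ordinal (c_subproof i)).
have c_inj : injective c.
  by move=> i j /enum_val_inj [] /val_inj.
have cE X : X \in lcosets K H -> exists i, c i = X.
  move=> XL; have lti : (enum_rank_in XL X < #|H : K|)%N by rewrite -cN.
  exists (Ordinal lti); rewrite -[RHS](enum_rankK_in XL XL) /c.
  by congr enum_val; apply: val_inj.
pose sigma h : 'S__ := odflt 1 [pick s : 'S_#|H : K| |
  [forall i, c (s i) == h *: c i]].
exists sigma, c; split=> //.
  apply/setP=> X; apply/imsetP/idP=> [[i _ ->]|/cE[i <-]]; last by exists i.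
  exact: enum_valP.
move=> h hH i; rewrite /sigma; case: pickP => /= [s /forallP/(_ i)/eqP //|no].
have ex j : {k | c k = h *: c j}.
  apply: cid; apply: cE; have /lcosetsP[x xH ->] : c j \in lcosets K H.
    exact: enum_valP.
  by apply/lcosetsP; exists (h * x); rewrite ?groupM // lcosetM.
pose f j := sval (ex j).
have f_inj : injective f.
  move=> j k /(congr1 c); rewrite /f (svalP (ex j)) (svalP (ex k)).
  by move/lcoset_inj/c_inj.
have /forallP[] := no (perm f_inj) => j; apply/eqP.
by rewrite permE /f (svalP (ex j)).
Qed.

(** Through coset representatives, families indexed by cosets become explicit:
    [h r_i] and [r_(sigma h i)] differ by an element of [K], on which the
    stabiliser or equivariance hypotheses apply. *)
Lemma perm_rep_reprs K H n (sigma : gT -> 'S_n) : perm_rep K H sigma ->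
  exists r : 'I_n -> gT,
    [/\ forall i, r i \in H,
        forall i j, (r i)^-1 * r j \in K -> i = j &
        forall h, h \in H -> forall i, (r (sigma h i))^-1 * (h * r i) \in K].
Proof.
case=> c [c_inj cL cE].
have cP i : exists2 x, x \in H & c i = x *: K.
  by apply/lcosetsP; rewrite -cL imset_f.
pose r i := odflt 1 [pick x in H | c i == x *: K].
have rP i : r i \in H /\ c i = r i *: K.
  rewrite /r; case: pickP => [x /andP[xH /eqP //]|no] /=.
  by have [x xH cx] := cP i; move: (no x); rewrite xH cx eqxx.
exists r; split=> [i|i j rK|h hH i]; first by have [] := rP i.
  apply: c_inj; have [_ ->] := rP i; have [_ ->] := rP j.
  by apply/esym/lcoset_eqP; rewrite mem_lcoset.

have := cE h hH i; have [_ ->] := rP i; have [_ ->] := rP (sigma h i).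
by rewrite -lcosetM => /esym/lcoset_eqP; rewrite mem_lcoset.
Qed.

(** The base coset [K] has stabiliser [K]. *)
Lemma perm_rep_base K H n (sigma : gT -> 'S_n) : perm_rep K H sigma ->
  exists i0, forall h, h \in H -> (sigma h i0 = i0 <-> h \in K).
Proof.
case=> c [c_inj cL cE].
have : (K : {set gT}) \in lcosets K H.
  by apply/lcosetsP; exists 1; rewrite ?lcoset1.
rewrite -cL => /imsetP[i0 _ Ki0]; exists i0 => h hH; split=> [sh|hK].
  by have := cE h hH i0; rewrite sh -Ki0 => ->; rewrite mem_lcoset mulVg group1.
by apply: c_inj; rewrite cE // -Ki0 lcoset_id.
Qed.

End Cosets.

(** * Steiner operads and stabilisers *)

Section Shrink.
Import Order.TTheory GRing.Theory Num.Theory.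
Import numFieldNormedType.Exports.
Local Open Scope ring_scope.
Variables (R : realType) (V : normedModType R).
Implicit Types (v w : V) (s : R).

(** For [s > 0] this embeds [V] in the open ball of radius [1 / s], and it
    tends to the identity as [s] tends to 0. *)
Definition shrink s v := (1 + s * `|v|)^-1 *: v.
Definition unshrink s w := (1 - s * `|w|)^-1 *: w.

Lemma shrink0 v : shrink 0 v = v.
Proof. by rewrite /shrink mul0r addr0 invr1 scale1r. Qed.

Lemma shrink_den s v : 0 <= s -> 0 < 1 + s * `|v|.
Proof. by move=> s0; rewrite ltr_pwDl // mulr_ge0. Qed.

Lemma norm_shrink s v : 0 <= s -> `|shrink s v| = `|v| / (1 + s * `|v|).
Proof.
move=> s0; rewrite normrZ [RHS]mulrC ger0_norm // invr_ge0.
exact/ltW/shrink_den.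
Qed.

Lemma shrink_bounded s v : 0 <= s -> s * `|shrink s v| < 1.
Proof.
move=> s0; have d0 := shrink_den v s0.
by rewrite norm_shrink // mulrA ltr_pdivrMr // mul1r ltrDr.
Qed.

Lemma shrinkK s v : 0 <= s -> unshrink s (shrink s v) = v.
Proof.
move=> s0; have d0 := shrink_den v s0.
rewrite /unshrink norm_shrink // /shrink scalerA -invfM.
suff -> : (1 - s * (`|v| / (1 + s * `|v|))) * (1 + s * `|v|) = 1.
  by rewrite invr1 scale1r.
by field; rewrite gt_eqF.
Qed.

(** If [|w| <= |v|], the difference of the images is
    [b (v - w) - s (|v| - |w|) w] divided by [a b], with [a = 1 + s |v|] and
    [b = 1 + s |w|]. Its norm is at most [(1 + 2 s |w|) |v - w| / (a b)], and
    [1 + 2 s |w| <= b^2 <= a b]. *)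
Lemma shrink_lipschitz s v w : 0 <= s ->
  `|shrink s v - shrink s w| <= `|v - w|.
Proof.
move=> s0; wlog le_wv : v w / `|w| <= `|v|.
  move=> wl; have [/wl//|/ltW/wl] := lerP `|w| `|v|.
  by rewrite distrC [X in _ <= X]distrC.
have a0 := shrink_den v s0; have b0 := shrink_den w s0.
set a := 1 + _ * _ in a0; set b := 1 + _ * _ in b0.
have -> : shrink s v - shrink s w =
    (a * b)^-1 *: (b *: (v - w) - (s * (`|v| - `|w|)) *: w).
  rewrite /shrink -/a -/b scalerBr !scalerBr !scalerA -addrA -opprD -scalerDl.
  congr (_ *: _ - _ *: _); first by field; rewrite (gt_eqF a0) (gt_eqF b0).
  by rewrite /a /b; field; rewrite -/a -/b ?(gt_eqF a0) ?(gt_eqF b0).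
have ab0 : 0 < a * b by exact: mulr_gt0.
rewrite normrZ ger0_norm ?invr_ge0 ?(ltW ab0) // mulrC ler_pdivrMr //.
apply: le_trans (ler_normB _ _) _.
rewrite !normrZ (gtr0_norm b0) (ger0_norm s0).
have dv : `| `|v| - `|w| | <= `|v - w| by exact: ler_dist_dist.
have le1 : s * `| `|v| - `|w| | * `|w| <= s * `|w| * `|v - w|.
  by rewrite mulrAC ler_wpM2l // mulr_ge0.
apply: le_trans (lerD (lexx _) le1) _.
rewrite -mulrDl mulrC ler_wpM2l //.
apply: (@le_trans _ _ (b * b)); last by rewrite ler_pM2r // lerD2l ler_wpM2l.
have sw : 0 <= s * `|w| by rewrite mulr_ge0.
by rewrite /b; nra.
Qed.

(** Continuity in the parameter, uniform on bounded sets. *)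
Lemma shrink_time s s' v : 0 <= s -> 0 <= s' ->
  `|shrink s v - shrink s' v| <= `|s - s'| * `|v| ^+ 2.
Proof.
move=> s0 s'0; have a0 := shrink_den v s0; have b0 := shrink_den v s'0.
rewrite /shrink -scalerBl normrZ expr2 mulrA ler_wpM2r //.
set a := 1 + _ in a0 *; set b := 1 + _ in b0 *.
have -> : a^-1 - b^-1 = (s' - s) * `|v| / (a * b).
  by rewrite /a /b; field; rewrite -/a -/b ?(gt_eqF a0) ?(gt_eqF b0).
have ab1 : 1 <= a * b.
  by apply: mulr_ege1; rewrite lerDl mulr_ge0.
rewrite !normrM normr_id distrC normfV ler_piMr ?mulr_ge0 //.
rewrite ger0_norm; first by rewrite invf_le1 // mulr_gt0.
by rewrite ltW // mulr_gt0.
Qed.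

Lemma continuous_shrink s : 0 <= s -> continuous (shrink s).
Proof.
move=> s0 v; apply: cvgZ; last exact: cvg_id.
apply: cvgV; first by rewrite gt_eqF // shrink_den.
apply: cvgD; first exact: cvg_cst.
by apply: cvgM; [exact: cvg_cst | apply: cvg_norm; exact: cvg_id].
Qed.

Lemma continuous_unshrink s w :
  s * `|w| < 1 -> {for w, continuous (unshrink s)}.
Proof.
move=> s1; apply: cvgZ; last exact: cvg_id.
apply: cvgV; first by rewrite gt_eqF // subr_gt0.
apply: cvgB; first exact: cvg_cst.
by apply: cvgM; [exact: cvg_cst | apply: cvg_norm; exact: cvg_id].
Qed.

End Shrink.

Section SteinerCriterion.
Import Order.TTheory GRing.Theory Num.Theory.
Import numFieldNormedType.Exports.
Local Open Scope classical_set_scope.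
Local Open Scope ring_scope.
Variables (R : realType) (gT : finGroupType) (U : orthrep R gT).
Implicit Types (K H : {group gT}) (u v w : U) (V : set U).

Definition orbit_span u : set U :=
  [set \sum_(i < #|gT|) c i *: rep_act U (enum_val i) u
     | c in [set: 'I_#|gT| -> R]].

Lemma orbit_span_subrep u : fin_subrep (orbit_span u).
Proof.
split; first by exists #|gT|, (fun i => rep_act U (enum_val i) u).
move=> g _ [c _ <-].
exists (fun i => c (enum_rank (g^-1 * enum_val i)%g)) => //.
rewrite linear_sum /=.
rewrite !(reindex _ (onW_bij _ (@enum_rank_bij gT))) /=.
rewrite (reindex_inj (mulgI g)) /=; apply: eq_bigr => h _.
by rewrite linearZ /= -rep_actM !enum_rankK mulKg.
Qed.

Lemma orbit_span_orbit u g : orbit_span u (rep_act U g u).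
Proof.
exists (fun i => (i == enum_rank g)%:R) => //.
rewrite (bigD1 (enum_rank g)) //= eqxx scale1r enum_rankK big1 ?addr0 //.
by move=> i /negPf ->; rewrite scale0r.
Qed.

Lemma orbit_spanP u a v w :
  orbit_span u v -> orbit_span u w -> orbit_span u (a *: v + w).
Proof.
move=> [c _ <-] [d _ <-]; exists (fun i => a * c i + d i) => //.
rewrite scaler_sumr -big_split; apply: eq_bigr => i _ /=.
by rewrite scalerDl scalerA.
Qed.

Lemma orbit_span0 u : orbit_span u 0.
Proof. by exists (fun=> 0) => //; rewrite big1 // => i _; rewrite scale0r. Qed.

Lemma orbit_spanZ u a v : orbit_span u v -> orbit_span u (a *: v).
Proof.
move=> Vv; rewrite -[_ *: _]addr0.
exact: orbit_spanP (orbit_span0 u).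
Qed.

Lemma orbit_spanD u v w :
  orbit_span u v -> orbit_span u w -> orbit_span u (v + w).
Proof. by rewrite -[v in _ (v + _)]scale1r; exact: orbit_spanP. Qed.

(** A path from an embedding into the ball of radius [1 / S] around [x], at
    time 0, to the identity, at time 1. The absolute value makes the formula
    continuous on all of [R]. *)
Definition shrink_path (S : R) (x : U) (t : R) (v : U) : U :=
  (1 - t) *: x + shrink (`|1 - t| * S) v.

(** A compact set is bounded, say by [M], and there the paths move with speed
    at most [|x| + S M^2]. *)
Lemma shrink_path_continuous (S : R) x V : 0 <= S ->
  continuous (shrink_path S x : R -> {family compactly_in V, U -> U}).
Proof.
move=> S0 t; apply/fam_cvgP => A [_ /compact_bounded [M [_ bA]]].
have {}bA v : A v -> `|v| <= `|M| + 1.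
  move=> Av; apply: bA => //; apply: le_lt_trans (ler_norm M) _.
  by rewrite ltrDl.
move=> P /uniform_nbhs[E [+ EP]]; rewrite -entourage_ballE => -[e /= e0 eE].
pose L := `|x| + S * (`|M| + 1) ^+ 2.
have L0 : 0 <= L by rewrite addr_ge0 // mulr_ge0 // exprn_ge0 // addr_ge0.
have Lp : 0 < L + 1 by rewrite ltr_wpDl.
suff : \forall t' \near t, P (shrink_path S x t') by [].
near=> t'; apply: EP => /= v Av; apply: eE => /=; rewrite -ball_normE /=.
have tt' : `|t - t'| < e / (L + 1).
  near: t'; have := @nbhsx_ballx _ R t (e / (L + 1)) (divr_gt0 e0 Lp).
  by apply: filterS => t' /=; rewrite -ball_normE.
have -> : shrink_path S x t v - shrink_path S x t' v = (t' - t) *: x +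
    (shrink (`|1 - t| * S) v - shrink (`|1 - t'| * S) v).
  rewrite /shrink_path opprD addrACA -scalerBl; congr (_ *: _ + _); ring.
apply: le_lt_trans (ler_normD _ _) _; rewrite normrZ distrC.
have le1 : `|shrink (`|1 - t| * S) v - shrink (`|1 - t'| * S) v| <=
    `|t - t'| * (S * (`|M| + 1) ^+ 2).
  apply: le_trans (shrink_time _ _ _) _; rewrite ?mulr_ge0 //.
  rewrite -mulrBl normrM (ger0_norm S0) -mulrA.
  have d1 : `| `|1 - t| - `|1 - t'| | <= `|t - t'|.
    apply: le_trans (ler_dist_dist _ _) _; rewrite distrC.
    by rewrite (_ : 1 - t' - (1 - t) = t - t') //; ring.
  apply: ler_pM => //; first by rewrite mulr_ge0 // exprn_ge0.
  by rewrite ler_wpM2l // lerXn2r ?nnegrE ?addr_ge0 // bA.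
apply: le_lt_trans (lerD (lexx _) le1) _; rewrite -mulrDr -/L.
apply: (@le_lt_trans _ _ (`|t - t'| * (L + 1))).
  by rewrite ler_wpM2l // lerDl.
by rewrite -ltr_pdivlMr.
Unshelve. all: by end_near. Qed.

Lemma shrink_pathB S x t v :
  shrink_path S x t v - (1 - t) *: x = shrink (`|1 - t| * S) v.
Proof. by rewrite /shrink_path addrC addKr. Qed.

Lemma shrink_path_RV (S : R) x t u : 0 <= S -> orbit_span u x ->
  RV (orbit_span u) (shrink_path S x t).
Proof.
move=> S0 Vx; have s0 : 0 <= `|1 - t| * S by rewrite mulr_ge0.
split.
- move=> _ [v Vv <-]; apply: orbit_spanD; apply: orbit_spanZ => //.
- move=> [v w] _ /=; rewrite mul1r.
  by rewrite opprD addrACA subrr add0r; exact: shrink_lipschitz.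
split.
  apply: continuous_subspaceT => v; apply: cvgD; first exact: cvg_cst.
  exact: continuous_shrink.
exists (fun w => unshrink (`|1 - t| * S) (w - (1 - t) *: x)); split.
  by move=> v _; rewrite shrink_pathB shrinkK.
apply: continuous_in_subspaceT => w; rewrite inE => -[v _ <-].
apply: (@continuous_comp _ _ _ (fun w => w - (1 - t) *: x)).
  by apply: cvgB; [exact: cvg_id | exact: cvg_cst].
apply: continuous_unshrink.
by rewrite shrink_pathB shrink_bounded.
Qed.

(** At time 0 the images lie in open balls of radius [1 / S]. *)
Lemma shrink_path_disjoint (S : R) x y v w : 0 < S -> 2 / S <= `|x - y| ->
  shrink_path S x 0 v <> shrink_path S y 0 w.
Proof.
move=> S0 far; rewrite /shrink_path subr0 normr1 mul1r !scale1r => eq_vw.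
have : x - y = shrink S w - shrink S v.
  by apply/eqP; rewrite subr_eq addrAC [_ + y]addrC -eq_vw addrK.
move/(congr1 Num.norm) => dE.
have hv := shrink_bounded v (ltW S0); have hw := shrink_bounded w (ltW S0).
have := ler_normB (shrink S w) (shrink S v); rewrite -dE => le_d.
have : 2 <= S * `|x - y| by rewrite mulrC -ler_pdivrMr.
rewrite leNgt => /negP; apply.
apply: (@le_lt_trans _ _ (S * (`|shrink S w| + `|shrink S v|))).
  by rewrite ler_pM2l.
by rewrite mulrDr; lra.
Qed.

Lemma separation_scale n (x : 'I_n -> U) : injective x ->
  exists2 S : R, 0 < S & forall i j, i != j -> 2 / S <= `|x i - x j|.
Proof.
move=> x_inj.
pose F (ij : 'I_n * 'I_n) : R := 2 / `|x ij.1 - x ij.2|.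
have F0 ij : 0 <= F ij by rewrite divr_ge0.
have S0 : 0 < 1 + \sum_ij F ij by rewrite ltr_pwDl // sumr_ge0.
exists (1 + \sum_ij F ij) => // i j nij.
have d0 : 0 < `|x i - x j| by rewrite normr_gt0 subr_eq0 (inj_eq x_inj).
rewrite ler_pdivrMr // -ler_pdivrMl // mulrC.
rewrite (bigD1 (i, j)) //= addrCA lerDl addr_ge0 // sumr_ge0 //.
Qed.

(** The points are [h_i(0)(0)]: the equality in the colimit defining
    [K(U)(n)] preserves them, and disjointness of the images makes them
    distinct. Conversely the paths contract [V], the span of the orbit of [u],
    to small balls around the translates of [u]. *)
Lemma steiner_relP K H : steiner_rel U K H <->
  (K \subset H /\
   exists u, forall h, h \in H -> (h \in K <-> rep_act U h u = u)).
Proof.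
split=> [[sKH [sigma [prep [V [h [[Vfin Vact] [hpath hdisj] hfix]]]]]]|].
  split=> //.
  have V0 : V 0.
    have [n [b ->]] := Vfin; exists (fun=> 0) => //.
    by rewrite big1 // => i _; rewrite scale0r.
  have h0E a i : a \in graph_of H sigma ->
      rep_act U a.1 (h (a.2^-1%g i) 0 0) = h i 0 0.
    move=> /hfix[W [k [[_ sVW _ _] [im1 im2]]]].
    have t0 : (0 : R) \in `[0, 1] by rewrite in_itv /= lexx ler01.
    have W0 : W 0 by exact: sVW.
    have orth0 v : V v -> dot U v 0 = 0 by rewrite linear0r.
    have := im2 i 0 0 0 t0 V0 W0 orth0.
    rewrite (im1 i 0 0 0 t0 V0 W0 orth0) !addr0 /KV_act.
    by rewrite linear0.
  have [i0 i0P] := perm_rep_base prep.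
  exists (h i0 0 0) => g gH.
  have gE : rep_act U g (h i0 0 0) = h (sigma g i0) 0 0.
    have := h0E (g, sigma g) (sigma g i0); rewrite /= permK; apply.
    by apply/imsetP; exists g.
  rewrite gE -i0P //; split=> [-> //|eq_h].
  by apply/eqP/negP => /negP ne; case: (hdisj _ _ 0 0 ne V0 V0).
move=> [sKH [u uP]]; split=> //.
have [sigma prep] := perm_rep_exists sKH; exists sigma; split=> //.
have [r [rH r_inj rP]] := perm_rep_reprs prep.
pose x i := rep_act U (r i) u.
have x_inj : injective x.
  move=> i j xE; apply: r_inj.
  have rH' : ((r i)^-1 * r j)%g \in H by rewrite groupM ?groupV.
  by apply/uP => //; rewrite rep_actM -/(x j) -xE rep_actK.
have xE g i : g \in H -> rep_act U g (x i) = x (sigma g i).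
  move=> gH; have kK := rP g gH i; have kH := fintype.subsetP sKH _ kK.
  have := (uP _ kH).1 kK; rewrite !rep_actM.
  by move/(congr1 (rep_act U (r (sigma g i)))); rewrite rep_actKV.
have [S S0 far] := separation_scale x_inj.
have KVx : KV (orbit_span u) (fun i => shrink_path S (x i)).
  split=> [i|i j v w nij _ _]; last exact/shrink_path_disjoint/far.
  split=> [t _||v _].
  - by apply: shrink_path_RV (ltW S0) _; exact: orbit_span_orbit.
  - by apply: continuous_subspaceT; apply: shrink_path_continuous (ltW S0).
  - by rewrite /shrink_path subrr scale0r add0r normr0 mul0r shrink0.
exists (orbit_span u), (fun i => shrink_path S (x i)).
split=> //; first exact: orbit_span_subrep.
move=> a /imsetP[g gH ->{a}].
have actE : KV_act (U := U) (g, sigma g) (fun i => shrink_path S (x i)) =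
    fun i => shrink_path S (x i).
  apply/funext => i; apply/funext => t; apply/funext => v.
  rewrite /KV_act /shrink_path /= linearD linearZ /= xE // permKV.
  by rewrite /shrink norm_act linearZ /= rep_actKV.

have im : KV_image (orbit_span u) (orbit_span u)
    (fun i => shrink_path S (x i)) (fun i => shrink_path S (x i)).
  move=> i t v w _ _ Vw orth; have -> : w = 0 by apply: dot_eq0; exact: orth.
  by rewrite !addr0.
rewrite actE; exists (orbit_span u), (fun i => shrink_path S (x i)).
by split; split=> //; exact: orbit_span_subrep.
Qed.

End SteinerCriterion.

(** * Linear isometries operads *)

Section LinearIsometriesCriterion.
Import Order.TTheory GRing.Theory Num.Theory.
Local Open Scope ring_scope.
Variables (R : realType) (gT : finGroupType) (U : orthrep R gT).
Implicit Types (K H M : {group gT}) (u v w : U).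

(** By Frobenius reciprocity, an [H]-equivariant isometry from the induced
    representation is determined by its restriction [f] to the base copy of
    [U]. *)
Definition induced_isometry K H (f : {linear U -> U}) : Prop :=
  [/\ forall u v, dot U (f u) (f v) = dot U u v,
      forall k u, k \in K -> f (rep_act U k u) = rep_act U k (f u)
    & forall h u v, h \in H -> h \notin K ->
        dot U (rep_act U h (f u)) (f v) = 0].

Definition inj_summand n (i0 : 'I_n) u : {ffun 'I_n -> U} :=
  [ffun i => if i == i0 then u else 0].

Lemma inj_summand_linear n (i0 : 'I_n) : linear (inj_summand i0).
Proof.
move=> a u v; apply/ffunP => i; rewrite !ffunE.
by case: eqP => _ //; rewrite scaler0 addr0.
Qed.

HB.instance Definition _ n (i0 : 'I_n) :=
  GRing.isLinear.Build R U {ffun 'I_n -> U} *:%R (inj_summand i0)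
    (inj_summand_linear i0).

(** Restrict to the base coset in one direction, and in the other extend by
    equivariance, [x |-> sum_i r_i f (r_i^-1 x_i)]. *)
Lemma linisom_relP K H : linisom_rel U K H <->
  K \subset H /\ exists f, induced_isometry K H f.
Proof.
split=> [[sKH [sigma [prep [f f_iso f_fix]]]]|[sKH [f [f_iso f_equiv f_orth]]]].
  split=> //; have [i0 i0P] := perm_rep_base prep.
  exists (f \o inj_summand i0).
  (* [H] permutes the copies of [U] as it permutes the cosets. *)
  have actE h u : h \in H ->
      rep_act U h (f (inj_summand i0 u)) =
      f (inj_summand (sigma h i0) (rep_act U h u)).
    move=> hH; have := f_fix (h, sigma h) (imset_f _ hH)
                         (inj_summand (sigma h i0) (rep_act U h u)).
    rewrite /linisom_act /= => <-; congr (rep_act U h (f _)).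
    apply/ffunP => i; rewrite !ffunE (inj_eq perm_inj).
    by case: eqP => _; rewrite ?rep_actK ?linear0.
  split=> [u v|k u kK|h u v hH hK] /=.
  - rewrite f_iso (bigD1 i0) //= big1 => [|i /negPf ni].
      by rewrite !ffunE eqxx addr0.
    by rewrite !ffunE ni linear0r.
  - have kH := fintype.subsetP sKH _ kK.
    by rewrite actE // (i0P k kH).2.
  - rewrite actE // f_iso big1 // => i _; rewrite !ffunE.
    case: eqP => [->|_]; last by rewrite linear0l.
    case: eqP => [/(i0P h hH).1 hK'|_]; last by rewrite linear0r.
    by rewrite hK' in hK.
split=> //; have [sigma prep] := perm_rep_exists sKH; exists sigma; split=> //.
have [r [rH r_inj rP]] := perm_rep_reprs prep.
pose F (x : {ffun 'I_#|H : K|%g -> U}) : U :=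
  \sum_i rep_act U (r i) (f (rep_act U (r i)^-1%g (x i))).
have F_lin : linear F.
  move=> a x y; rewrite /F scaler_sumr -big_split; apply: eq_bigr => i _ /=.
  by rewrite !ffunE !linearP.
pose FL := GRing.isLinear.Build R _ _ *:%R F F_lin.
pose F' : {linear {ffun 'I_#|H : K|%g -> U} -> U} := HB.pack F FL.
exists F' => [x y|a /imsetP[h hH ->{a}] x].
  rewrite /= /F linear_sumlz; apply: eq_bigr => i _.
  rewrite linear_sumr (bigD1 i) //= big1 ?addr0 => [|j ji].
    by rewrite rep_act_isom f_iso rep_act_isom.
  have rjiH : ((r j)^-1 * r i)%g \in H by rewrite groupM ?groupV.
  rewrite dotC dot_act dotC -rep_actM f_orth //.
  by apply/negP => /r_inj ij; rewrite ij eqxx in ji.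
rewrite /linisom_act /= /F linear_sum /=.
rewrite [RHS](reindex_inj (@perm_inj _ (sigma h))) /=.
apply: eq_bigr => i _; rewrite ffunE -rep_actM.
set j := sigma h i.
have kK := rP h hH i; rewrite -/j in kK.
have -> : (h * r i = r j * ((r j)^-1 * (h * r i)))%g by rewrite mulKVg.
rewrite rep_actM -f_equiv // -!rep_actM.
by congr (rep_act U _ (f (rep_act U _ _))); rewrite !mulgA mulgK mulgK.
Qed.

Lemma linisom_rel_refl K : linisom_rel U K K.
Proof.
apply/linisom_relP; split=> //; exists idfun.
by split=> // h u v -> .
Qed.

(** [u] generates a copy of the regular representation of [M], with
    orthonormal basis its orbit. *)
Definition free_orbit M u : Prop :=
  dot U u u = 1 /\ forall m, m \in M -> m != 1%g -> dot U (rep_act U m u) u = 0.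

Lemma free_orbitS M K u : K \subset M -> free_orbit M u -> free_orbit K u.
Proof.
by move=> sKM [u1 uM]; split=> // m mK; apply: uM; apply: (fintype.subsetP sKM).
Qed.

Lemma free_orbit_scale M u : u != 0 ->
  (forall m, m \in M -> m != 1%g -> dot U (rep_act U m u) u = 0) ->
  free_orbit M (`|u|^-1 *: u).
Proof.
move=> u0 uM; have n0 : `|u| != 0 by rewrite normr_eq0.
split=> [|m mM m1]; last first.
  by rewrite [rep_act U m _]linearZ dotZl dotZr uM // !mulr0.
by rewrite dotZl dotZr dot_norm expr2 mulKf // mulVf.
Qed.

(** The vector [f u] has the free orbit: [f] is equivariant under the part of
    [M] in [K], and moves its image to an orthogonal one under the rest. *)
Lemma linisom_free_orbit K H M u :
  linisom_rel U K H -> M \subset H -> free_orbit (M :&: K) u ->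
  exists v, free_orbit M v.
Proof.
move=> /linisom_relP[sKH [f [f_iso f_equiv f_orth]]] sMH [u1 uMK].
exists (f u); split=> [|m mM m1]; first by rewrite f_iso.
have [mK|mK] := boolP (m \in K).
  by rewrite -f_equiv // f_iso uMK // inE mM.
by rewrite f_orth // (fintype.subsetP sMH).
Qed.

(** The sum [z] of the translates of [f v] under [M] is fixed by [M], and [K]
    acts on it as on [v], since [f] is [K]-equivariant. As the translates are
    orthogonal, [z] determines [v], so [K] fixes [v] if it fixes [z]. *)
Lemma linisom_fixed_trivial K H M :
  linisom_rel U K H -> M \subset H -> M :&: K = 1%g -> (M \subset 'C(K))%g ->
  (forall u, (forall m, m \in M -> rep_act U m u = u) ->
             forall k, k \in K -> rep_act U k u = u) ->
  forall k v, k \in K -> rep_act U k v = v.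
Proof.
move=> /linisom_relP[sKH [f [f_iso f_equiv f_orth]]] sMH tiMK cMK fixMK k v kK.
pose z w := \sum_(m in M) rep_act U m (f w).
have zM w m : m \in M -> rep_act U m (z w) = z w.
  move=> mM; rewrite /z linear_sum /= [RHS](reindex_inj (mulgI m)) /=.
  by apply: eq_big => [x|x _]; rewrite ?groupMl // rep_actM.
have zk : z (rep_act U k v) = z v.
  rewrite -[RHS](fixMK _ (zM v) k kK) /z linear_sum /=.
  apply: eq_bigr => m mM; rewrite f_equiv // -!rep_actM.
  by rewrite (centP (fintype.subsetP cMK m mM)).
apply/eqP; rewrite -subr_eq0; apply/eqP/dot_eq0; rewrite -[LHS]f_iso.
set w := rep_act U k v - v.
have z0 : z w = 0.
  rewrite /z (eq_bigr (fun m => rep_act U m (f (rep_act U k v)) -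
                                rep_act U m (f v))); last first.
    by move=> m _; rewrite /w !linearB.
  by rewrite sumrB -/(z _) zk subrr.
have := congr1 (fun x => dot U x (f w)) z0; rewrite linear0l /z linear_sumlz.
rewrite (bigD1 1%g) ?group1 //= rep_act1 big1 ?addr0 // => m /andP[mM m1].
rewrite f_orth // ?(fintype.subsetP sMH) //; apply: contra m1 => mK.
have : m \in M :&: K by rewrite inE mM.
by rewrite tiMK => /set1gP ->.
Qed.

End LinearIsometriesCriterion.

(** * Orthonormal bases and free orbits *)

Section GramSchmidt.
Import Order.TTheory GRing.Theory Num.Theory.
Local Open Scope ring_scope.
Variables (R : realType) (gT : finGroupType) (U : orthrep R gT).
Implicit Types (u v w : U).

Definition span (e : nat -> U) n u : Prop :=
  exists c : nat -> R, u = \sum_(i < n) c i *: e i.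

Lemma span_lin e n a u v : span e n u -> span e n v -> span e n (a *: u + v).
Proof.
move=> [c ->] [d ->]; exists (fun i => a * c i + d i).
rewrite scaler_sumr -big_split; apply: eq_bigr => i _ /=.
by rewrite scalerDl scalerA.
Qed.

Lemma span0 e n : span e n 0.
Proof. by exists (fun=> 0); rewrite big1 // => i _; rewrite scale0r. Qed.

Lemma spanZ e n a u : span e n u -> span e n (a *: u).
Proof.
by move=> eu; rewrite -[_ *: _]addr0; apply: span_lin eu (span0 e n).
Qed.

Lemma span_sum e n m (F : 'I_m -> U) :
  (forall i, span e n (F i)) -> span e n (\sum_i F i).
Proof.
move=> eF; elim/big_rec: _ => [|i u _ eu]; first exact: span0.
by rewrite -[F i]scale1r; apply: span_lin.
Qed.

Lemma span_mem e n i : (i < n)%N -> span e n (e i).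
Proof.
move=> lt_in; exists (fun j => (j == i)%:R).
rewrite (bigD1 (Ordinal lt_in)) //= eqxx scale1r big1 ?addr0 // => j.
by rewrite -val_eqE /= => /negPf ->; rewrite scale0r.
Qed.

Lemma span_mono e m n u : (m <= n)%N -> span e m u -> span e n u.
Proof.
move=> le_mn [c ->]; apply: span_sum => i; apply: spanZ; apply: span_mem.
exact: leq_trans (ltn_ord i) le_mn.
Qed.

Variable e : nat -> U.

(** The vectors built so far are carried as a sequence, which makes the
    recursion structural. *)
Definition gs_residue (s : seq U) n : U :=
  e n - \sum_(x <- s) dot U (e n) x *: x.

Definition gs_unit (s : seq U) n : U :=
  `|gs_residue s n|^-1 *: gs_residue s n.

Fixpoint gs_seq n : seq U :=
  if n is m.+1 then rcons (gs_seq m) (gs_unit (gs_seq m) m) else [::].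

Definition gram_schmidt n : U := gs_unit (gs_seq n) n.
Let o := gram_schmidt.
Let w n := e n - \sum_(i < n) dot U (e n) (o i) *: o i.

Lemma gs_seqE n : gs_seq n = [seq o i | i <- iota 0 n].
Proof.
elim: n => // n IHn.
by rewrite -[n.+1]addn1 iotaD map_cat -IHn cats1 addn1.
Qed.

Lemma gram_schmidtE n : o n = `|w n|^-1 *: w n.
Proof.
rewrite /o /gram_schmidt /gs_unit.
suff -> : gs_residue (gs_seq n) n = w n by [].
have iE : iota 0 n = index_iota 0 n by rewrite /index_iota subn0.
by rewrite /gs_residue gs_seqE big_map iE big_mkord.
Qed.

Hypothesis e_free : forall n (c : nat -> R),
  \sum_(i < n) c i *: e i = 0 -> forall i, (i < n)%N -> c i = 0.

Lemma gram_schmidt_span n : span e n.+1 (o n).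
Proof.
have [m] := ubnP n; elim: m n => // m IHm n; rewrite ltnS => le_nm.
rewrite gram_schmidtE; apply: spanZ; rewrite /w addrC -scaleN1r.
apply: span_lin; last exact: span_mem.
apply: span_sum => i; apply: spanZ; apply: span_mono (IHm i _); last first.
  exact: leq_trans (ltn_ord i) le_nm.
exact: leqW.
Qed.

Lemma gs_residue_neq0 n : w n != 0.
Proof.
have [c cE] : span e n (\sum_(i < n) dot U (e n) (o i) *: o i).
  apply: span_sum => i; apply: spanZ.
  exact: span_mono (ltn_ord i) (gram_schmidt_span i).
apply/eqP; rewrite /w cE => w0.
have /(_ _ n (ltnSn n)) := @e_free n.+1 (fun i => if i == n then 1 else - c i).
rewrite eqxx => c1; suff /c1/eqP : \sum_(i < n.+1)
    (if val i == n then 1 else - c i) *: e i = 0 by rewrite oner_eq0.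
rewrite big_ord_recr /= eqxx scale1r addrC -[RHS]w0; congr (_ + _).
rewrite -sumrN; apply: eq_bigr => i _.
by rewrite (ltn_eqF (ltn_ord i)) scaleNr.
Qed.

Lemma gram_schmidt_orthonormal i j : dot U (o i) (o j) = (i == j)%:R.
Proof.
suff on n : forall i j, (i < n)%N -> (j < n)%N ->
    dot U (o i) (o j) = (i == j)%:R.
  by apply: (on (maxn i j).+1); rewrite ltnS ?leq_maxl ?leq_maxr.
elim: n => // n IHn {}i {}j.
have orth k : (k < n)%N -> dot U (o n) (o k) = 0.
  move=> lt_kn; rewrite gram_schmidtE dotZl.
  suff -> : dot U (w n) (o k) = 0 by rewrite mulr0.
  rewrite /w linearBl /= linear_sumlz.
  rewrite (bigD1 (Ordinal lt_kn)) //= dotZl IHn // eqxx mulr1.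
  rewrite big1 ?addr0 ?subrr // => l.
  by rewrite -val_eqE /= => /negPf kl; rewrite dotZl IHn // kl mulr0.
rewrite !ltnS (leq_eqVlt i) (leq_eqVlt j).
move=> /predU1P[->|ltin] /predU1P[->|ltjn].
- rewrite eqxx gram_schmidtE dotZl dotZr dot_norm expr2.
  have n0 : `|w n| != 0 by rewrite normr_eq0 gs_residue_neq0.
  by rewrite mulKf // mulVf.
- by rewrite orth // (gtn_eqF ltjn).
- by rewrite dotC orth // (ltn_eqF ltin).
- exact: IHn.
Qed.

Lemma gram_schmidt_basis n u : span e n u ->
  u = \sum_(i < n) dot U u (o i) *: o i.
Proof.
move=> [c uE].
have [d {}uE] : span o n u.
  rewrite uE; apply: span_sum => i; apply: spanZ.
  have -> : e i = `|w i| *: o i + \sum_(j < i) dot U (e i) (o j) *: o j.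
    rewrite gram_schmidtE scalerA mulfV ?normr_eq0 ?gs_residue_neq0 //.
    by rewrite scale1r subrK.
  apply: span_lin; first exact: span_mem.
  apply: span_sum => j; apply: spanZ; apply: span_mem.
  exact: ltn_trans (ltn_ord j) (ltn_ord i).
rewrite {1}uE; apply: eq_bigr => i _; congr (_ *: _).
rewrite uE linear_sumlz (bigD1 i) //= dotZl gram_schmidt_orthonormal eqxx mulr1.
rewrite big1 ?addr0 // => j; rewrite -val_eqE => /negPf ji.
by rewrite dotZl gram_schmidt_orthonormal ji mulr0.
Qed.

End GramSchmidt.

Section FreeOrbits.
Import Order.TTheory GRing.Theory Num.Theory.
Local Open Scope ring_scope.
Variables (R : realType) (gT : finGroupType) (U : orthrep R gT).
Hypothesis U_universe : is_universe U.
Implicit Types (H M : {group gT}) (u v w : U).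

Lemma dot_sum m (a b : 'I_m -> R) (x y : 'I_m -> U) :
  dot U (\sum_(i < m) a i *: x i) (\sum_(j < m) b j *: y j) =
  \sum_(i < m) \sum_(j < m) a i * b j * dot U (x i) (y j).
Proof.
rewrite linear_sumlz; apply: eq_bigr => i _ /=.
rewrite linear_sumr; apply: eq_bigr => j _ /=.
by rewrite dotZl dotZr mulrA.
Qed.

Lemma orthonormal_basis : exists o : nat -> U,
  (forall i j, dot U (o i) (o j) = (i == j)%:R) /\
  forall u, exists n, u = \sum_(i < n) dot U u (o i) *: o i.
Proof.
have [[e [e_span e_free]] _ _] := U_universe; exists (gram_schmidt e).
split=> [|u]; first exact: gram_schmidt_orthonormal.
by have [n eu] := e_span u; exists n; apply: gram_schmidt_basis.
Qed.

(** The map sends the orthonormal basis [o] to the sequence [e], whose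
    translates under [g] need only have scalar products [c] or 0 with it; the
    value [c] is 1 for [g = 1], and 0 for the other elements of a group with
    free orbits. *)
Lemma isometry_onto (o e : nat -> U) :
  (forall i j, dot U (o i) (o j) = (i == j)%:R) ->
  (forall u, exists n, u = \sum_(i < n) dot U u (o i) *: o i) ->
  exists f : {linear U -> U}, forall g u v c,
    (forall i j, dot U (rep_act U g (e i)) (e j) = (i == j)%:R * c) ->
    dot U (rep_act U g (f u)) (f v) = c * dot U u v.
Proof.
move=> o_on o_span.
(* The coordinates of [u] vanish from the index [N u] on, so the sum that
   defines the map can be extended to any larger range: hence linearity. *)
pose N u := sval (cid (o_span u)).
have NP u : u = \sum_(i < N u) dot U u (o i) *: o i := svalP (cid (o_span u)).
have N_big u i : (N u <= i)%N -> dot U u (o i) = 0.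
  move=> leNi; rewrite {1}(NP u) linear_sumlz big1 // => j _.
  rewrite /= dotZl o_on (ltn_eqF (leq_trans (ltn_ord j) leNi)) mulr0 //.
pose f u := \sum_(i < N u) dot U u (o i) *: e i.
have widen (x : nat -> U) u m : (N u <= m)%N ->
    \sum_(i < N u) dot U u (o i) *: x i = \sum_(i < m) dot U u (o i) *: x i.
  move=> leNm; rewrite -!(big_mkord predT (fun i => dot U u (o i) *: x i)).
  rewrite [RHS](big_cat_nat (leq0n _) leNm) /= [X in _ = _ + X]big_nat_cond.
  rewrite [X in _ = _ + X]big1 ?addr0 // => i /andP[/andP[leNi _] _].
  by rewrite N_big // scale0r.
have f_lin : linear f.
  move=> a u v; set m := maxn (N (a *: u + v)) (maxn (N u) (N v)).
  rewrite /f (widen e _ m) ?leq_maxl // (widen e u m); last first.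
    by rewrite !leq_max leqnn orbT.
  rewrite (widen e v m); last by rewrite !leq_max leqnn !orbT.
  rewrite scaler_sumr -big_split; apply: eq_bigr => i _ /=.
  by rewrite linearDl /= dotZl scalerDl scalerA.
pose fL := GRing.isLinear.Build R _ _ *:%R f f_lin.
pose F : {linear U -> U} := HB.pack f fL.
exists F => g u v c gE; rewrite /= /f.
set m := maxn (N u) (N v).
rewrite (widen e u m) ?leq_maxl // (widen e v m) ?leq_maxr //.
rewrite [u in RHS]NP [v in RHS]NP.
rewrite (widen o u m) ?leq_maxl // (widen o v m) ?leq_maxr //.
have -> : rep_act U g (\sum_(i < m) dot U u (o i) *: e i) =
    \sum_(i < m) dot U u (o i) *: rep_act U g (e i).
  by rewrite linear_sum; apply: eq_bigr => i _; rewrite linearZ.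
rewrite !dot_sum mulr_sumr; apply: eq_bigr => i _.
by rewrite mulr_sumr; apply: eq_bigr => j _; rewrite gE o_on; ring.
Qed.

(** A universe contains the span of an orbit infinitely often. *)
Lemma free_orbit_copies H u : free_orbit H u ->
  exists e : nat -> U, forall h i j, h \in H ->
    dot U (rep_act U h (e i)) (e j) = (i == j)%:R * (h == 1%g)%:R.
Proof.
move=> [u1 uH]; have [_ copies _] := U_universe.
have [j [_ j_act j_iso j_orth]] := copies _ (orbit_span_subrep u).
have uV g : orbit_span u (rep_act U g u) by exact: orbit_span_orbit.
have uV1 : orbit_span u u by have := uV 1%g; rewrite rep_act1.
exists (j^~ u) => h k l hH; rewrite -j_act //.
have [->|kl] := eqVneq k l; last by rewrite mul0r j_orth //; apply/eqP.
rewrite mul1r j_iso //; have [->|h1] := eqVneq h 1%g; first by rewrite rep_act1.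
by rewrite uH.
Qed.

Lemma linisom_of_free_orbit H u : free_orbit H u -> linisom_rel U 1%G H.
Proof.
move=> /free_orbit_copies[e eP]; have [o [o_on o_span]] := orthonormal_basis.
have [f fP] := isometry_onto e o_on o_span.
apply/linisom_relP; split; first exact: sub1G.
exists f; split=> [u1 v1|k u1 /set1gP ->|h u1 v1 hH].
- rewrite -[f u1](rep_act1 (o := U)) (fP 1%g u1 v1 1) ?mul1r //.
  by move=> i j; rewrite eP ?group1 // eqxx.
- by rewrite !rep_act1.
- rewrite inE => /negPf h1; rewrite (fP h u1 v1 0) ?mul0r // => i j.
  by rewrite eP // h1.
Qed.

Lemma universe_unit :
  exists2 t : U, dot U t t = 1 & forall g, rep_act U g t = t.
Proof.
have [_ _ [t t0 tG]] := U_universe; exists (`|t|^-1 *: t).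
  have n0 : `|t| != 0 by rewrite normr_eq0.
  by rewrite dotZl dotZr dot_norm expr2 mulKf // mulVf.
by move=> g; rewrite linearZ /= tG.
Qed.

Lemma free_orbit1 : exists u : U, free_orbit 1%G u.
Proof.
have [t t1 _] := universe_unit; exists t; split=> // m /set1gP ->.
by rewrite eqxx.
Qed.

(** For [v] not fixed by [M], [w = v - g v] has zero average over [M], and in a
    group of order 2 or 3 all scalar products of [w] with its other translates
    are equal, by symmetry, hence negative. Adding a suitable fixed vector,
    orthogonal to the orbit of [w], makes them vanish. *)
Lemma small_order_free_orbit M g v :
  #|M| = 2 \/ #|M| = 3 -> g \in M -> rep_act U g v <> v ->
  exists u : U, free_orbit M u.
Proof.
move=> cardM gM gv.
have [t t1 tG] := universe_unit.
pose w := v - rep_act U g v.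
have w0 : w != 0 by rewrite subr_eq0; apply/eqP => /esym.
have wt m : dot U (rep_act U m w) t = 0.
  by rewrite dot_act tG /w linearBl /= dot_act tG subrr.
pose c := dot U (rep_act U g w) w.
have g1 : g != 1%g by apply/eqP => g1; apply: gv; rewrite g1 rep_act1.
have cM m : m \in M -> m != 1%g -> dot U (rep_act U m w) w = c.
  have M_prime : prime #|M| by case: cardM => ->.
  have ME : M :=: <[g]>%g.
    apply/eqP; rewrite eq_sym eqEcard cycle_subG gM /= -/(order g).
    have /(primeP M_prime).2 /orP[/eqP o1|/eqP -> //] := order_dvdG gM.
    by rewrite -order_eq1 o1 eqxx in g1.
  have og : #[g]%g = #|M| by rewrite /order ME.
  rewrite ME => /cyclePmin[[|[|[|i]]] lti ->]; rewrite og in lti.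
  - by rewrite expg0 eqxx.
  - by rewrite expg1.
  - move=> _; case: cardM => cM; rewrite cM // in lti og.
    have -> : (g ^+ 2 = g^-1)%g.
      apply/eqP; rewrite eq_sym eq_invg_mul -expgS.
      by rewrite -[X in _ == X](expg_order g) og.
    by rewrite dotC -dot_act.
  - by case: cardM => cM; rewrite cM in lti.
have c_lt0 : c < 0.
  rewrite ltNge; apply/negP => c_ge0.
  have : \sum_(m in M) dot U (rep_act U m w) w = 0.
    rewrite -linear_sumlz.
    rewrite (eq_bigr (fun m => rep_act U m v - rep_act U (m * g)%g v)).
      rewrite sumrB [X in _ - X](_ : _ = \sum_(m in M) rep_act U m v).
        by rewrite subrr linear0l.
      rewrite [RHS](reindex_inj (mulIg g)) /=; apply: eq_bigl => m.
      by rewrite groupMr.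
    by move=> m _; rewrite /w linearB rep_actM.
  rewrite (bigD1 1%g) ?group1 //= rep_act1 => s0.
  have : 0 < dot U w w.
    by rewrite lt_def dot_ge0 andbT; apply: contra w0 => /eqP/dot_eq0 ->.
  rewrite -[X in 0 < X]
    (addrK (\sum_(m in M | m != 1%g) dot U (rep_act U m w) w)).
  rewrite s0 sub0r oppr_gt0 ltNge sumr_ge0 // => m /andP[mM m1].
  by rewrite cM.
pose u := Num.sqrt (- c) *: t + w.
have uE m : dot U (rep_act U m u) u = - c + dot U (rep_act U m w) w.
  have uA : rep_act U m u = Num.sqrt (- c) *: t + rep_act U m w.
    by rewrite /u linearD linearZ /= tG.
  have tw : dot U t w = 0 by rewrite dotC -[w](rep_act1 (o := U)) wt.
  rewrite uA /u linearDl /= [dot U (_ *: t) _]linearDr /=.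
  rewrite [dot U (rep_act U m w) _]linearDr /= !dotZl !dotZr tw wt t1.
  by rewrite !mulr0 mulr1 addr0 add0r -expr2 sqr_sqrtr // oppr_ge0 ltW.
have u0 : u != 0.
  apply/eqP => u0; have := uE 1%g; rewrite u0 linear0r !rep_act1 => /eqP.
  by rewrite lt_eqF // ltr_pwDl ?oppr_gt0 // dot_ge0.
exists (`|u|^-1 *: u); apply: free_orbit_scale => // m mM m1.
by rewrite uE cM // addNr.
Qed.

End FreeOrbits.

(** * Finitely supported sequences *)

Section FiniteSequences.
Import Order.TTheory GRing.Theory Num.Theory.
Import numFieldNormedType.Exports.
Local Open Scope ring_scope.
Variables (R : realType).
Implicit Types (p q : {poly R}).

Definition dotp p q : R := \sum_(i < size p) p`_i * q`_i.

Lemma dotpE m p q : (size p <= m)%N -> dotp p q = \sum_(i < m) p`_i * q`_i.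
Proof.
move=> lem; rewrite /dotp (big_ord_widen m (fun i => p`_i * q`_i)) //.
rewrite big_mkcond; apply: eq_bigr => i _ /=.
by case: ltnP => // /(nth_default 0) ->; rewrite mul0r.
Qed.

Lemma dotpC p q : dotp p q = dotp q p.
Proof.
rewrite (@dotpE (maxn (size p) (size q))) ?leq_maxl //.
rewrite (@dotpE (maxn (size p) (size q)) q) ?leq_maxr //.
by apply: eq_bigr => i _; rewrite mulrC.
Qed.

Lemma dotp_linear p : linear_for *%R (dotp p).
Proof.
move=> a q r; rewrite /dotp mulr_sumr -big_split; apply: eq_bigr => i _ /=.
by rewrite coefD coefZ; ring.
Qed.

Lemma dotp_ge0 p : 0 <= dotp p p.
Proof. by apply: sumr_ge0 => i _; rewrite -expr2 sqr_ge0. Qed.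

Lemma dotp_eq0 p : dotp p p = 0 -> p = 0.
Proof.
move=> /eqP; rewrite psumr_eq0 => [/allP p0|i _]; last first.
  by rewrite -expr2 sqr_ge0.
apply/polyP => i; rewrite coef0.
have [/(nth_default 0) //|lti] := leqP (size p) i.
have /= := p0 (Ordinal lti) (mem_index_enum _).
by rewrite -expr2 sqrf_eq0 => /eqP.
Qed.

Lemma dotp0 p : dotp p 0 = 0.
Proof. by rewrite dotpC /dotp size_poly0 big_ord0. Qed.

Lemma dotpZr p a q : dotp p (a *: q) = a * dotp p q.
Proof. by have := dotp_linear p a q 0; rewrite !addr0 dotp0 addr0. Qed.

Lemma dotp_Xn i j : dotp 'X^i 'X^j = (i == j)%:R.
Proof.
rewrite /dotp size_polyXn (bigD1 ord_max) //= !coefXn eqxx mul1r big1 ?addr0 //.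
by move=> k; rewrite -val_eqE /= !coefXn => /negPf ->; rewrite mul0r.
Qed.

(** Finitely supported functions on [D * nat], with their standard inner
    product; a polynomial stands for the sequence of its coefficients. *)
Definition fseq (D : finType) := {ffun D -> {poly R}}.
HB.instance Definition _ (D : finType) := GRing.Lmodule.on (fseq D).

Variable D : finType.
Implicit Types (u v : fseq D).

Definition fdot u v : R := \sum_d dotp (u d) (v d).

Lemma fdotC u v : fdot u v = fdot v u.
Proof. by apply: eq_bigr => d _; exact: dotpC. Qed.

Lemma fdot_linear u : linear_for *%R (fdot u).
Proof.
move=> a v w; rewrite /fdot mulr_sumr -big_split; apply: eq_bigr => d _ /=.
by rewrite !ffunE dotp_linear.
Qed.

Lemma fdot_bilinear :
  bilinear_for (GRing.Scale.Law.clone _ _ *%R _)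
               (GRing.Scale.Law.clone _ _ (idfun \; *%R) _) fdot.
Proof.
split=> [v|u]; last exact: fdot_linear.
by move=> a x y; rewrite /= ![fdot _ v]fdotC fdot_linear.
Qed.

HB.instance Definition _ := bilinear_isBilinear.Build R (fseq D) (fseq D) R
  *%R (idfun \; *%R) fdot fdot_bilinear.

Lemma fdot_hermitian u v : fdot u v = (-1) ^+ false * idfun (fdot v u).
Proof. by rewrite expr0 mul1r fdotC. Qed.

HB.instance Definition _ := isHermitianSesquilinear.Build R (fseq D) false idfun
  fdot fdot_hermitian.

Lemma fdot_gt0 u : u != 0 -> 0 < fdot u u.
Proof.
move=> u0; rewrite lt_def sumr_ge0 => [|d _]; last exact: dotp_ge0.
rewrite andbT; apply: contra u0 => /eqP s0; apply/eqP/ffunP => d.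
rewrite ffunE; apply: dotp_eq0; apply/eqP; move/eqP: s0.
rewrite psumr_eq0 => [/allP/(_ d (mem_index_enum _)) //|e _]; exact: dotp_ge0.
Qed.

HB.instance Definition _ := isDotProduct.Build R (fseq D) fdot fdot_gt0.

Definition fdot_form : {dot (fseq D) for idfun} := fdot.

Definition fnorm u : R := Num.sqrt (fdot u u).

Lemma fdot_cauchy_schwarz u v : fdot u v <= fnorm u * fnorm v.
Proof.
have ge0 w : 0 <= fdot w w.
  by have [->|/fdot_gt0/ltW //] := eqVneq w 0; rewrite linear0l.
rewrite /fnorm -sqrtrM //; apply: le_trans (ler_norm _) _.
rewrite -sqrtr_sqr; apply: ler_wsqrtr.
have [->|/fdot_gt0 u0] := eqVneq u 0; first by rewrite !linear0l expr0n mul0r.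
have := ge0 (fdot u v *: u - fdot u u *: v).
rewrite linearBl /= [fdot _ (_ - _)]linearBr [fdot (_ *: v) (_ - _)]linearBr /=.
rewrite !linearZl_LR !linearZr_LR /= (fdotC v u).
set a := fdot u u in u0 *; set b := fdot u v; set c := fdot v v => h.
rewrite -subr_ge0 -(pmulr_rge0 _ u0).
by rewrite (le_trans h) // le_eqVlt; apply/orP; left; apply/eqP; ring.
Qed.

Lemma fnormD u v : fnorm (u + v) <= fnorm u + fnorm v.
Proof.
rewrite -(@ler_pXn2r _ 2) ?nnegrE ?addr_ge0 ?sqrtr_ge0 //.
have ge0 w : 0 <= fdot w w.
  by have [->|/fdot_gt0/ltW //] := eqVneq w 0; rewrite linear0l.
rewrite sqrrD !sqr_sqrtr //.
rewrite linearDl /= 2!linearDr /= (fdotC v u).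
have := fdot_cauchy_schwarz u v; set a := fdot u v; set b := fnorm u * _.
lra.
Qed.

Lemma fnormZ a u : fnorm (a *: u) = `|a| * fnorm u.
Proof.
rewrite /fnorm linearZl_LR linearZr_LR /= mulrA -expr2.
by rewrite sqrtrM ?sqr_ge0 // sqrtr_sqr.
Qed.

Lemma fnorm_eq0 u : fnorm u = 0 -> u = 0.
Proof.
move=> /eqP; rewrite sqrtr_eq0 => le0; apply/eqP/negP => /negP /fdot_gt0.
by rewrite ltNge le0.
Qed.

HB.instance Definition _ :=
  Lmodule_isNormed.Build R (fseq D) fnormD fnormZ fnorm_eq0.

Lemma fdot_norm u : fdot u u = `|u| ^+ 2.
Proof.
rewrite [RHS]sqr_sqrtr //; have [->|/fdot_gt0/ltW //] := eqVneq u 0.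
by rewrite linear0l.
Qed.

(** The [k]-th of infinitely many isometric embeddings with orthogonal images,
    which spread the coefficients along disjoint subsets of [nat]. *)
Definition shiftp (k : nat) p : {poly R} :=
  \sum_(i < size p) p`_i *: 'X^(pickle (k, val i)).

Lemma shiftpE k m p : (size p <= m)%N ->
  shiftp k p = \sum_(i < m) p`_i *: 'X^(pickle (k, val i)).
Proof.
move=> lem.
rewrite /shiftp (big_ord_widen m (fun i => p`_i *: 'X^(pickle (k, i)))) //.
rewrite big_mkcond; apply: eq_bigr => i _ /=.
by case: ltnP => // /(nth_default 0) ->; rewrite scale0r.
Qed.

Lemma shiftp_linear k : linear (shiftp k).
Proof.
move=> a p q; set m := maxn (size (a *: p + q)) (maxn (size p) (size q)).
rewrite !(@shiftpE k m) ?leq_maxl //; last 2 first.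
- by rewrite !leq_max leqnn !orbT.
- by rewrite !leq_max leqnn !orbT.
rewrite scaler_sumr -big_split; apply: eq_bigr => i _ /=.
by rewrite coefD coefZ scalerDl scalerA.
Qed.

HB.instance Definition _ k :=
  GRing.isLinear.Build R {poly R} {poly R} *:%R (shiftp k) (shiftp_linear k).

Lemma dotp_suml m (F : 'I_m -> {poly R}) q :
  dotp (\sum_i F i) q = \sum_i dotp (F i) q.
Proof.
elim/big_rec2: _ => [|i x y _ <-]; rewrite dotpC.
  by rewrite /dotp big1 // => i _; rewrite coef0 mulr0.
by rewrite -[X in dotp q (X + _)]scale1r dotp_linear mul1r ![dotp q _]dotpC.
Qed.

Lemma dotp_sum m (a b : 'I_m -> R) (x y : 'I_m -> {poly R}) :
  dotp (\sum_(i < m) a i *: x i) (\sum_(j < m) b j *: y j) =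
  \sum_(i < m) \sum_(j < m) a i * b j * dotp (x i) (y j).
Proof.
rewrite dotp_suml; apply: eq_bigr => i _; rewrite dotpC dotp_suml.
apply: eq_bigr => j _; rewrite dotpC dotpZr [dotp (a i *: _) _]dotpC dotpZr.
by rewrite [dotp (y j) _]dotpC mulrA (mulrC (b j)).
Qed.

Lemma dotp_shiftp k l p q :
  dotp (shiftp k p) (shiftp l q) = (k == l)%:R * dotp p q.
Proof.
set m := maxn (size p) (size q).
rewrite (@shiftpE k m) ?leq_maxl // (@shiftpE l m) ?leq_maxr // dotp_sum.
rewrite (@dotpE m p) ?leq_maxl // mulr_sumr; apply: eq_bigr => i _.
rewrite (bigD1 i) //= big1 => [|j ji].
  rewrite addr0 dotp_Xn (inj_eq (pcan_inj pickleK)) xpair_eqE eqxx andbT.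
  by rewrite mulrC.
rewrite dotp_Xn (inj_eq (pcan_inj pickleK)) xpair_eqE val_eqE eq_sym.
by rewrite [i == j]eq_sym (negPf ji) andbF mulr0.
Qed.

Definition fshift k u : fseq D := [ffun d => shiftp k (u d)].

Lemma fshift_linear k : linear (fshift k).
Proof. by move=> a u v; apply/ffunP => d; rewrite !ffunE linearP. Qed.

Lemma fdot_fshift k l u v :
  fdot (fshift k u) (fshift l v) = (k == l)%:R * fdot u v.
Proof.
by rewrite /fdot mulr_sumr; apply: eq_bigr => d _; rewrite !ffunE dotp_shiftp.
Qed.

Definition fsingle (d : D) p : fseq D := [ffun d' => if d' == d then p else 0].

(** The monomial vectors, listed with the index in [D] running fastest. *)
Definition fbasis (d0 : D) (m : nat) : fseq D :=
  fsingle (nth d0 (enum D) (m %% #|D|)) 'X^(m %/ #|D|).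

Lemma fbasis_coef (d0 : D) m d k :
  (fbasis d0 m d)`_k = (m == k * #|D| + enum_rank d)%N%:R.
Proof.
have N0 : (0 < #|D|)%N by apply/card_gt0P; exists d0.
rewrite /fbasis ffunE -(enum_val_nth d0 (Ordinal (ltn_pmod m N0))).
rewrite -(inj_eq (@enum_rank_inj D)) enum_valK -val_eqE /=.
have -> : (m == k * #|D| + enum_rank d)%N =
    (val (enum_rank d) == (m %% #|D|)%N) && (k == m %/ #|D|)%N.
  apply/eqP/andP => [->|[/eqP -> /eqP ->]]; last by rewrite -divn_eq.
  rewrite modnMDl modn_small ?ltn_ord // divnMDl // divn_small ?ltn_ord //.
  by rewrite addn0 !eqxx.
by case: eqP => _; rewrite ?coefXn ?coef0.
Qed.

Lemma fbasis_sum_coef (d0 : D) n (c : nat -> R) d k :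
  ((\sum_(i < n) c i *: fbasis d0 i) d)`_k =
  if (k * #|D| + enum_rank d < n)%N then c (k * #|D| + enum_rank d)%N else 0.
Proof.
rewrite sum_ffunE coef_sum.
under eq_bigr => i _ do rewrite ffunE coefZ fbasis_coef.
case: ltnP => [lt|le].
  rewrite (bigD1 (Ordinal lt)) //= eqxx mulr1 big1 ?addr0 // => i.
  by rewrite -val_eqE => /negPf /= ->; rewrite mulr0.
rewrite big1 // => i _; rewrite (ltn_eqF _) ?mulr0 //.
exact: leq_trans (ltn_ord i) le.
Qed.

Lemma fbasis_span (d0 : D) u : exists n (c : nat -> R),
  u = \sum_(i < n) c i *: fbasis d0 i.
Proof.
have N0 : (0 < #|D|)%N by apply/card_gt0P; exists d0.
pose m := (\max_d size (u d))%N.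
pose c i := (u (nth d0 (enum D) (i %% #|D|)))`_(i %/ #|D|).
exists (m * #|D|)%N, c; apply/ffunP => d; apply/polyP => k.
rewrite (fbasis_sum_coef d0 _ c) /c.
rewrite modnMDl modn_small ?ltn_ord // divnMDl // divn_small ?ltn_ord // addn0.
rewrite -(enum_val_nth d0) enum_rankK.
case: ltnP => // le; apply: nth_default.
apply: leq_trans (@leq_bigmax D (fun d => size (u d)) d) _.
rewrite -/m leqNgt; apply/negP => lt_km.
move: le; rewrite leqNgt => /negP; apply.
apply: (@leq_trans (k.+1 * #|D|)); last by rewrite leq_mul2r lt_km orbT.
by rewrite mulSn addnC ltn_add2r ltn_ord.
Qed.

Lemma fbasis_free (d0 : D) n (c : nat -> R) :
  \sum_(i < n) c i *: fbasis d0 i = 0 -> forall i, (i < n)%N -> c i = 0.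
Proof.
move=> c0 i lt_in; have N0 : (0 < #|D|)%N by apply/card_gt0P; exists d0.
pose r := Ordinal (ltn_pmod i N0).
have := fbasis_sum_coef d0 n c (enum_val r) (i %/ #|D|).
rewrite enum_valK /= -divn_eq lt_in c0 => <-.
by rewrite ffunE coef0.
Qed.

End FiniteSequences.

(** * Universes built from rotations *)

Section RotationUniverse.
Import Order.TTheory GRing.Theory Num.Theory.
Import numFieldNormedType.Exports.
Local Open Scope ring_scope.
Variables (R : realType) (gT : finGroupType) (J : finType).
(* The j-th character is g |-> C j g + i S j g. *)
Variables (C S : J -> gT -> R).
Hypotheses (C1 : forall j, C j 1%g = 1) (S1 : forall j, S j 1%g = 0).
Hypothesis CS : forall j g, C j g ^+ 2 + S j g ^+ 2 = 1.
Hypothesis CM : forall j g h, C j (g * h)%g = C j g * C j h - S j g * S j h.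
Hypothesis SM : forall j g h, S j (g * h)%g = S j g * C j h + C j g * S j h.

Let D : finType := (J * bool)%type.
Implicit Types (u v : fseq R D).

(** [D] indexes the real ([false]) and imaginary ([true]) parts of the complex
    lines on which [g] acts by the characters. *)
Definition rotate g u : fseq R D :=
  [ffun d => C d.1 g *: u d +
             ((if d.2 then 1 else -1) * S d.1 g) *: u (d.1, ~~ d.2)].

Lemma rotate_linear g : linear (rotate g).
Proof.
move=> a u v; apply/ffunP => d; rewrite !ffunE !scalerDr !scalerA.
by rewrite addrACA; congr (_ *: _ + _ *: _ + _); ring.
Qed.

HB.instance Definition _ g :=
  GRing.isLinear.Build R (fseq R D) (fseq R D) *:%R (rotate g)
    (rotate_linear g).

Lemma rotate1 u : rotate 1%g u = u.
Proof.
by apply/ffunP => d; rewrite ffunE C1 S1 mulr0 scale0r addr0 scale1r.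
Qed.

Lemma rotateM g h u : rotate (g * h)%g u = rotate g (rotate h u).
Proof.
apply/ffunP => -[j b]; rewrite !ffunE CM SM /= negbK !scalerDr !scalerA.
rewrite [X in _ = _ + X]addrC addrACA -!scalerDl.
by congr (_ *: _ + _ *: _); case: b => /=; ring.
Qed.

Lemma dotpDZ p q p' q' (a b a' b' : R) :
  dotp (a *: p + b *: q) (a' *: p' + b' *: q') =
  a * a' * dotp p p' + a * b' * dotp p q' +
  b * a' * dotp q p' + b * b' * dotp q q'.
Proof.
have lin (r s t : {poly R}) c d :
    dotp r (c *: s + d *: t) = c * dotp r s + d * dotp r t.
  by rewrite dotp_linear dotpZr.
rewrite lin ![dotp (_ + _) _]dotpC !lin ![dotp _ p]dotpC ![dotp _ q]dotpC.
by ring.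
Qed.

Lemma fdot_pair u v : fdot u v =
  \sum_j (dotp (u (j, true)) (v (j, true)) +
          dotp (u (j, false)) (v (j, false))).
Proof.
transitivity (\sum_j \sum_b dotp (u (j, b)) (v (j, b))).
  by rewrite pair_bigA; apply: eq_bigr => -[].
by apply: eq_bigr => j _; rewrite big_bool.
Qed.

Lemma rotate_isometry g u v : fdot (rotate g u) (rotate g v) = fdot u v.
Proof.
rewrite !fdot_pair; apply: eq_bigr => j _; rewrite !ffunE /= !dotpDZ.
have := CS j g; set c := C j g; set s := S j g => cs.
by rewrite -[RHS]mul1r -[X in _ = X * _]cs; ring.
Qed.

Definition rotation_rep : orthrep R gT :=
  @OrthRep R gT (fseq R D) (@fdot_form R D)
    (@fdot_norm R D)
    (fun g => rotate g) rotate1 rotateM rotate_isometry.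

Lemma rotation_sin0 j g : C j g = 1 -> S j g = 0.
Proof.
move=> c1; have /eqP := CS j g.
by rewrite c1 expr1n addrC -subr_eq0 addrK sqrf_eq0 => /eqP.
Qed.

(** Infinite multiplicity comes from the embeddings [fshift k], which commute
    with the action on the whole space, as they only move coefficients. *)
Lemma rotation_universe (j0 : J) :
  (forall g, C j0 g = 1) -> is_universe rotation_rep.
Proof.
move=> C0; have S0 g : S j0 g = 0 by apply: rotation_sin0.
pose d0 : D := (j0, false).
split.
- exists (fbasis R d0); split; [exact: fbasis_span | exact: fbasis_free].
- move=> V _; exists (@fshift R D); split.
  + by move=> k a u v _ _; exact: fshift_linear.
  + move=> k g v _; apply/ffunP => d; rewrite !ffunE.
    by rewrite linearD !linearZ.
  + by move=> k u v _ _; rewrite [LHS]fdot_fshift eqxx mul1r.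
  + by move=> k l u v /eqP/negPf kl _ _; rewrite [LHS]fdot_fshift kl mul0r.
exists (fsingle d0 1 : fseq R D) => [|g]; last first.
  apply/ffunP => -[j b]; rewrite !ffunE /=.
  have [jb|jb] := eqVneq (j, b) d0.
    by move: jb => [-> ->]; rewrite C0 S0 mulr0 scale0r addr0 scale1r.
  rewrite scaler0 add0r; case: eqP => [[-> _]|_]; last by rewrite scaler0.
  by rewrite S0 mulr0 scale0r.
apply/eqP => /ffunP/(_ d0)/eqP; rewrite !ffunE eqxx.
by rewrite oner_eq0.
Qed.

(** A nontrivial rotation has no nonzero fixed point. *)
Lemma rotation_fixedP g (u : rotation_rep) :
  rep_act rotation_rep g u = u <->
  (forall d, (u : fseq R D) d <> 0 -> C d.1 g = 1).
Proof.
split=> [gu [j b] /= u0|fixu].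
  have /ffunP gu' : rotate g u = u := gu.
  have e1 := gu' (j, b); have e2 := gu' (j, ~~ b).
  apply/eqP/negP => /negP c1; apply: u0; apply/polyP => k.
  have {e1}/(congr1 (fun p : {poly R} => p`_k)) := e1.
  have {e2}/(congr1 (fun p : {poly R} => p`_k)) := e2.
  rewrite !ffunE /= !negbK !coefD !coefZ coef0.
  have := CS j g; set c := C j g in c1 *; set s := S j g.
  set x := (u (j, b))`_k; set y := (u (j, ~~ b))`_k => cs e2 e1.
  have c1' : 1 - c != 0 by rewrite subr_eq0 eq_sym.
  (* [(1 - c)^2 + s^2 = 2 (1 - c)] is the determinant of the rotation minus
     the identity. *)
  have : 2 * (1 - c) * x = 0.
    rewrite (_ : 2 * (1 - c) * x = ((1 - c) ^+ 2 + s ^+ 2) * x); last first.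
      rewrite -[s ^+ 2](addrK (c ^+ 2)) [s ^+ 2 + _]addrC cs; ring.
    pose t := (if b then 1 else -1) * s.
    have E1 : (1 - c) * x - t * y = 0 by rewrite /t; case: (b) e1 => /=; lra.
    have E2 : (1 - c) * y + t * x = 0 by rewrite /t; case: (b) e2 => /=; lra.
    transitivity ((1 - c) * ((1 - c) * x - t * y) + t * ((1 - c) * y + t * x)).
      by rewrite /t; case: (b); ring.
    by rewrite E1 E2 !mulr0 addr0.
  by move/eqP; rewrite !mulf_eq0 pnatr_eq0 /= (negPf c1') => /eqP.
apply/ffunP => -[j b]; rewrite [LHS]ffunE /=.
have S0 := @rotation_sin0 j g.
have [u0|/eqP u0] := eqVneq (u (j, b)) 0; last first.
  by have c1 := fixu _ u0; rewrite c1 S0 // mulr0 scale0r addr0 scale1r.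
rewrite u0 scaler0 add0r; have [->|/eqP v0] := eqVneq (u (j, ~~ b)) 0.
  by rewrite scaler0.
by rewrite S0 ?mulr0 ?scale0r //; have := fixu _ v0.
Qed.

End RotationUniverse.

(** * Angles that are rational multiples of a full turn *)

Section Angles.
Import Order.TTheory GRing.Theory Num.Theory.
Local Open Scope ring_scope.
Variables (R : realType) (n : nat).
Hypothesis n_gt0 : (0 < n)%N.
Implicit Types (a b : nat).

Definition turn a : R := pi *+ 2 * (a%:R / n%:R).
Definition tcos a : R := cos (turn a).
Definition tsin a : R := sin (turn a).

Let n0 : n%:R != 0 :> R. Proof. by rewrite pnatr_eq0 -lt0n. Qed.

Lemma turnD a b : turn (a + b) = turn a + turn b.
Proof. by rewrite /turn natrD; field. Qed.

Lemma turn_full a : turn (a * n) = pi *+ 2 *+ a.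
Proof. by rewrite /turn natrM mulfK // mulr_natr. Qed.

Lemma tcos0 : tcos 0 = 1. Proof. by rewrite /tcos /turn mul0r mulr0 cos0. Qed.
Lemma tsin0 : tsin 0 = 0. Proof. by rewrite /tsin /turn mul0r mulr0 sin0. Qed.

Lemma tcosD a b : tcos (a + b) = tcos a * tcos b - tsin a * tsin b.
Proof. by rewrite /tcos turnD cosD. Qed.

Lemma tsinD a b : tsin (a + b) = tsin a * tcos b + tcos a * tsin b.
Proof. by rewrite /tsin turnD sinD. Qed.

Lemma tcos_mod a : tcos (a %% n) = tcos a.
Proof.
rewrite {2}(divn_eq a n) addnC /tcos turnD turn_full.
by rewrite (periodicn (@cosD2pi R)).
Qed.

Lemma tsin_mod a : tsin (a %% n) = tsin a.
Proof.
rewrite {2}(divn_eq a n) addnC /tsin turnD turn_full.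
by rewrite (periodicn (@sinD2pi R)).
Qed.

Lemma tcos2_tsin2 a : tcos a ^+ 2 + tsin a ^+ 2 = 1.
Proof. exact: cos2Dsin2. Qed.

(** [1 - cos x = 2 sin^2 (x / 2)], and the sine is positive inside [0, pi]. *)
Lemma tcos_eq1 a : (tcos a == 1) = (n %| a)%N.
Proof.
rewrite -tcos_mod /dvdn; have [->|] := eqVneq (a %% n)%N 0%N.
  by rewrite tcos0 eqxx.
rewrite -lt0n => b0; have bn := ltn_pmod a n_gt0.
move: (a %% n)%N b0 bn => b b0 bn.
pose x : R := pi * (b%:R / n%:R).
have xE : turn b = x *+ 2 by rewrite /turn /x [LHS]mulrnAl.
have nR : 0 < n%:R :> R by rewrite ltr0n.
have x_in : 0 < x < pi.
  rewrite mulr_gt0 ?pi_gt0 ?divr_gt0 ?ltr0n //= gtr_pMr ?pi_gt0 //.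
  by rewrite ltr_pdivrMr // mul1r ltr_nat.
apply/negbTE; rewrite /tcos xE cos_mulr2n.
have s0 := exprn_gt0 2 (sin_gt0_pi x_in); have cs := cos2Dsin2 x.
by rewrite lt_eqF //; lra.
Qed.

Lemma tsin_eq0 a : (n %| a)%N -> tsin a = 0.
Proof. by move=> /eqP na; rewrite -tsin_mod na tsin0. Qed.

(** The sum over a full period is invariant under a nontrivial rotation. *)
Lemma sum_tcos r a : (n %| r * a)%N -> ~~ (n %| a)%N ->
  \sum_(j < r) tcos (j * a) = 0.
Proof.
move=> nra na.
have shift (f : nat -> R) :
    f r = f 0%N -> \sum_(j < r) f j.+1 = \sum_(j < r) f j.
  move=> f0; have e : \sum_(j < r.+1) f j = f 0%N + \sum_(j < r) f j.+1.
    by rewrite big_ord_recl.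
  by apply: (@addrI _ (f 0%N)); rewrite -e big_ord_recr /= f0 addrC.
pose A := \sum_(j < r) tcos (j * a); pose B := \sum_(j < r) tsin (j * a).
have eA : A = tcos a * A - tsin a * B.
  rewrite {1}/A -(shift (fun j => tcos (j * a))); last first.
    by rewrite mul0n tcos0; apply/eqP; rewrite tcos_eq1.
  rewrite !mulr_sumr -sumrB; apply: eq_bigr => j _.
  by rewrite mulSn tcosD.
have eB : B = tsin a * A + tcos a * B.
  rewrite {1}/B -(shift (fun j => tsin (j * a))); last first.
    by rewrite mul0n tsin0 tsin_eq0.
  rewrite !mulr_sumr -big_split; apply: eq_bigr => j _ /=.
  by rewrite mulSn tsinD.
rewrite -/A; have c1 : 1 - tcos a != 0 by rewrite subr_eq0 eq_sym tcos_eq1.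
have cs := tcos2_tsin2 a.
have : 2 * (1 - tcos a) * A = 0.
  transitivity (((1 - tcos a) ^+ 2 + tsin a ^+ 2) * A).
    rewrite -[tsin a ^+ 2](addrK (tcos a ^+ 2)) [_ + tcos a ^+ 2]addrC cs; ring.
  have E1 : (1 - tcos a) * A + tsin a * B = 0 by lra.
  have E2 : (1 - tcos a) * B - tsin a * A = 0 by lra.
  transitivity ((1 - tcos a) * ((1 - tcos a) * A + tsin a * B) -
                tsin a * ((1 - tcos a) * B - tsin a * A)); first ring.
  by rewrite E1 E2 !mulr0 subr0.
by move/eqP; rewrite !mulf_eq0 pnatr_eq0 /= (negPf c1) => /eqP.
Qed.

End Angles.

(** * Universes of a cyclic group *)

Section CyclicUniverse.
Import Order.TTheory GRing.Theory Num.Theory.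
Local Open Scope ring_scope.
Variables (R : realType) (gT : finGroupType) (z : gT).
Hypothesis z_gen : <[z]>%g = [set: gT]%SET.
Let n := #|gT|.

Lemma order_gen : #[z]%g = n. Proof. by rewrite /order z_gen cardsT. Qed.

Lemma card_gen_gt0 : (0 < n)%N. Proof. by rewrite -order_gen order_gt0. Qed.

Lemma dlog_exists g : exists i, (z ^+ i == g)%g.
Proof.
have : g \in <[z]>%g by rewrite z_gen inE.
by case/cycleP => i ->; exists i.
Qed.

Definition dlog g : nat := ex_minn (dlog_exists g).

Lemma dlogK g : (z ^+ dlog g)%g = g.
Proof. by rewrite /dlog; case: ex_minnP => i /eqP. Qed.

Lemma dlogX i : (dlog (z ^+ i)%g = i %[mod n])%N.
Proof. by apply/eqP; rewrite -order_gen -eq_expg_mod_order dlogK. Qed.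

Lemma dlogM g h : (dlog (g * h)%g = dlog g + dlog h %[mod n])%N.
Proof.
by apply/eqP; rewrite -order_gen -eq_expg_mod_order expgD !dlogK.
Qed.

Lemma dlog1 : (n %| dlog 1%g)%N.
Proof. by rewrite -order_gen order_dvdn dlogK. Qed.

Lemma dlog_eq1 g : (n %| dlog g)%N = (g == 1%g).
Proof. by rewrite -order_gen order_dvdn dlogK. Qed.

(** In a cyclic group, a subgroup consists of the solutions of [g ^ r = 1],
    for [r] its order. *)
Lemma mem_dlog (A : {group gT}) g : (g \in A) = (n %| #|A| * dlog g)%N.
Proof.
rewrite mulnC -order_gen order_dvdn expgM dlogK -order_dvdn -cycle_subG.
rewrite (cardSg_cyclic (G := [set: gT]%G)) ?finset.subsetT //.
by rewrite /= -z_gen cycle_cyclic.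
Qed.

Variable I : pred nat.
Let J := {k : 'I_n | I k}.

(** The character of index [k] sends the generator to a rotation by [k / n]
    turns; [I] selects the characters that occur. *)
Definition char_cos (j : J) g : R := tcos R n (val (val j) * dlog g).
Definition char_sin (j : J) g : R := tsin R n (val (val j) * dlog g).

Let modM k g h :
  (k * dlog (g * h)%g = k * dlog g + k * dlog h %[mod n])%N.
Proof. by rewrite -mulnDr -modnMmr dlogM modnMmr. Qed.

Lemma char_cos1 j : char_cos j 1%g = 1.
Proof.
by apply/eqP; rewrite tcos_eq1 ?card_gen_gt0 // dvdn_mull // dlog1.
Qed.

Lemma char_sin1 j : char_sin j 1%g = 0.
Proof. by rewrite /char_sin tsin_eq0 ?card_gen_gt0 // dvdn_mull // dlog1. Qed.

Lemma char_cosM j g h :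
  char_cos j (g * h)%g =
  char_cos j g * char_cos j h - char_sin j g * char_sin j h.
Proof.
have n0 := card_gen_gt0.
by rewrite /char_cos -tcos_mod // modM tcos_mod // tcosD.
Qed.

Lemma char_sinM j g h :
  char_sin j (g * h)%g =
  char_sin j g * char_cos j h + char_cos j g * char_sin j h.
Proof.
have n0 := card_gen_gt0.
by rewrite /char_sin -tsin_mod // modM tsin_mod // tsinD.
Qed.

Definition cyc_rep : orthrep R gT :=
  rotation_rep char_cos1 char_sin1 (fun j g => tcos2_tsin2 _ _ _)
               char_cosM char_sinM.

Implicit Types (u v : cyc_rep) (d : (J * bool)%type).

Definition component u d : {poly R} := (u : fseq R (J * bool)%type) d.

Lemma cyc_rep_universe : I 0 -> is_universe cyc_rep.
Proof.
move=> I0; pose j0 : J := exist _ (Ordinal card_gen_gt0) I0.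
apply: (@rotation_universe _ _ _ _ _ _ _ _ _ _ j0) => g.
by apply/eqP; rewrite tcos_eq1 ?card_gen_gt0.
Qed.

Lemma cyc_fixedP g u : rep_act cyc_rep g u = u <->
  (forall d, component u d <> 0 -> (n %| val (val d.1) * dlog g)%N).
Proof.
split=> [/rotation_fixedP fu d /fu /eqP|fu].
  by rewrite tcos_eq1 ?card_gen_gt0.
by apply/rotation_fixedP => d /fu nd; apply/eqP; rewrite tcos_eq1 ?card_gen_gt0.
Qed.

(** The first real vector in the line of the character of index [k]. *)
Definition cvec (k : nat) : cyc_rep :=
  ([ffun d : (J * bool)%type =>
      if (val (val d.1) == k) && ~~ d.2 then 1 else 0]
   : fseq R (J * bool)%type).

Lemma component_cvec k d : component (cvec k) d <> 0 -> val (val d.1) = k.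
Proof. by rewrite /component ffunE; case: eqP. Qed.

Lemma cvec_component k : (k < n)%N -> I k ->
  exists2 d : (J * bool)%type, val (val d.1) = k &
    forall l, component (cvec l) d = (l == k)%:R.
Proof.
move=> ltkn Ik; exists (exist _ (Ordinal ltkn) Ik, false) => // l.
by rewrite /component ffunE /= andbT eq_sym; case: eqP.
Qed.

Lemma cvec_fixedP k g : (k < n)%N -> I k ->
  (rep_act cyc_rep g (cvec k) = cvec k <-> (n %| k * dlog g)%N).
Proof.
move=> ltkn Ik; split=> [/cyc_fixedP fk|nk].
  have [d dk dE] := cvec_component ltkn Ik.
  rewrite -dk; apply: fk; rewrite dE eqxx.
  by apply/eqP; rewrite oner_eq0.
by apply/cyc_fixedP => d /component_cvec ->.
Qed.

Lemma cvec_dot k l g : (k < n)%N -> I k ->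
  dot cyc_rep (rep_act cyc_rep g (cvec k)) (cvec l) =
  (k == l)%:R * tcos R n (k * dlog g).
Proof.
move=> ltkn Ik; rewrite [LHS]fdot_pair.
pose j0 : J := exist _ (Ordinal ltkn) Ik.
rewrite (bigD1 j0) //= big1 => [|j /eqP jk].
  rewrite addr0 !ffunE /= !andbF !andbT eqxx dotp0 add0r scaler0 addr0.
  case: eqP => _; last by rewrite dotp0 mul0r.
  have dotp1 : dotp 1 1 = 1 :> R by rewrite -(expr0 'X) dotp_Xn.
  by rewrite mul1r dotpC -[_ *: 1]addr0 dotp_linear dotp0 addr0 dotp1 mulr1.
have nk : (val (val j) == k) = false.
  by apply/eqP => jk'; apply: jk; apply/val_inj/val_inj.
rewrite !ffunE /= nk /= !scaler0 addr0 dotpC dotp0 dotpC dotp0 addr0 //.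
Qed.

(** The powers of a faithful character of [A] exhaust its characters, so that
    the sum of one vector in each generates the regular representation. The
    character of index [s] is faithful on [A], as [#|A|] is prime to [s]. *)
Lemma cyc_free_orbit (A : {group gT}) s :
  n = (#|A| * s)%N -> coprime #|A| s ->
  (forall j, (j < #|A|)%N -> I (j * s)) ->
  exists u, free_orbit A u.
Proof.
move=> nE cop Is.
have s0 : (0 < s)%N by have := card_gen_gt0; rewrite nE muln_gt0 => /andP[].
pose u : cyc_rep := \sum_(j < #|A|) cvec (j * s).
have uE g : dot cyc_rep (rep_act cyc_rep g u) u =
    \sum_(j < #|A|) tcos R n (j * (s * dlog g)).
  have -> : rep_act cyc_rep g u =
      \sum_(j < #|A|) rep_act cyc_rep g (cvec (j * s)) by rewrite linear_sum.
  rewrite linear_sumlz; apply: eq_bigr => j _ /=.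
  have jn : (j * s < n)%N by rewrite nE ltn_pmul2r.
  rewrite linear_sumr (bigD1 j) //= big1 ?addr0 => [|k kj].
    by rewrite cvec_dot ?Is // eqxx mul1r mulnA.
  rewrite cvec_dot ?Is // eqn_pmul2r // eq_sym.
  by rewrite (_ : (k == j :> nat) = false) ?mul0r //; apply/negbTE.
exists (`|u|^-1 *: u); apply: free_orbit_scale => [|g gA g1].
  apply/eqP => u0; have := uE 1%g.
  rewrite rep_act1 u0 linear0l => /eqP.
  under eq_bigr => j _.
    rewrite (_ : tcos R n _ = 1); last first.
      by apply/eqP; rewrite tcos_eq1 ?card_gen_gt0 // !dvdn_mull // dlog1.
    over.
  by rewrite sumr_const card_ord eq_sym pnatr_eq0 eqn0Ngt cardG_gt0.
have := gA; rewrite mem_dlog => nAg.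
rewrite uE sum_tcos ?card_gen_gt0 //.
  by rewrite mulnCA dvdn_mull.
apply: contra g1 => nsg; rewrite -dlog_eq1 -/n nE Gauss_dvd //.
move: nAg; rewrite -/n nE dvdn_pmul2l ?cardG_gt0 // => ->.
by move: nsg; rewrite nE mulnC dvdn_pmul2l // => ->.
Qed.

End CyclicUniverse.

(** * Cyclic groups of order a product of two primes *)

Section TwoPrimes.
Import Order.TTheory GRing.Theory Num.Theory.
Variables (R : realType) (gT : finGroupType) (z : gT).
Hypothesis z_gen : <[z]>%g = [set: gT]%SET.

Notation G := [set: gT]%G.

(** The character of index [k] is trivial on the subgroup of order [r] exactly
    if [r] divides [k]. *)
Lemma cyc_fixed_by (A : {group gT}) (I : pred nat) (u : cyc_rep R z_gen I) :
  (forall d, component u d <> 0%R -> #|A| %| val (val d.1)) ->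
  forall g, g \in A -> rep_act _ g u = u.
Proof.
move=> uA g gA; apply/cyc_fixedP => d /uA /dvdnP[k ->].
by rewrite -mulnA dvdn_mull // -mem_dlog.
Qed.

Lemma cyc_fixed_byP (A : {group gT}) s (I : pred nat) (u : cyc_rep R z_gen I) :
  #|gT| = #|A| * s -> (forall g, g \in A -> rep_act _ g u = u) ->
  forall d, component u d <> 0%R -> #|A| %| val (val d.1).
Proof.
move=> nE uA d ud.
have s0 : 0 < s by have := card_gen_gt0 z_gen; rewrite nE muln_gt0 => /andP[].
have zA : (z ^+ s)%g \in A.
  by rewrite (mem_dlog z_gen) /dvdn -modnMmr dlogX modnMmr nE modnn.
have /cyc_fixedP/(_ d ud) := uA _ zA.
move: (val (val d.1)) => k.
by rewrite /dvdn -modnMmr dlogX modnMmr -/(_ %| _) nE dvdn_pmul2r.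
Qed.

Lemma steiner_of_free_point (U : orthrep R gT) (H : {group gT}) (u : U) :
  (forall h, h \in H -> rep_act U h u = u -> h = 1%g) -> steiner_rel U 1%G H.
Proof.
move=> uH; apply/steiner_relP; split; first exact: sub1G.
exists u => h hH; split=> [/set1gP ->|/(uH _ hH) ->]; first exact: rep_act1.
exact: group1.
Qed.

Lemma steiner_free_point (U : orthrep R gT) (H : {group gT}) :
  steiner_rel U 1%G H ->
  exists u : U, forall h, h \in H -> rep_act U h u = u -> h = 1%g.
Proof.
by move=> /steiner_relP[_ [u uH]]; exists u => h hH /(uH h hH) /set1gP.
Qed.

Lemma steiner_rel_refl (U : orthrep R gT) (H : {group gT}) : steiner_rel U H H.
Proof.
apply/steiner_relP; split=> //; exists 0%R => h hH.
by rewrite linear0; split.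
Qed.

Variables A B : {group gT}.
Hypotheses (A_prime : prime #|A|) (B_prime : prime #|B|).
Hypotheses (neq_AB : #|A| != #|B|) (card_G : #|gT| = #|A| * #|B|).

Let nBA : #|gT| = #|B| * #|A|. Proof. by rewrite card_G mulnC. Qed.

Lemma coprime_AB : coprime #|A| #|B|.
Proof. by rewrite prime_coprime // dvdn_prime2. Qed.

Lemma tiAB : (A :&: B = 1)%g.
Proof. exact: coprime_TIg coprime_AB. Qed.

Lemma abelian_G (H K : {group gT}) : (H \subset 'C(K))%g.
Proof.
have cG : abelian [set: gT]%SET by rewrite -z_gen cycle_abelian.
by apply: sub_abelian_cent2 cG _ _; apply: finset.subsetT.
Qed.

Lemma eq_subgroup (H K : {group gT}) : #|H| = #|K| -> H = K.
Proof.
move=> cHK; apply/val_inj/eqP => /=.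
rewrite (eq_subG_cyclic (G := G)) ?finset.subsetT ?cHK //.
by rewrite /= -z_gen cycle_cyclic.
Qed.

Lemma subgroup_cases (H : {group gT}) : [\/ H = 1%G, H = A, H = B | H = G].
Proof.
have dH : #|H| %| #|A| * #|B| by rewrite -card_G -cardsT cardSg ?finset.subsetT.
have [AH|nAH] := boolP (#|A| %| #|H|).
  have [m mE] := dvdnP AH; move: dH; rewrite mE mulnC dvdn_pmul2l ?prime_gt0 //.
  case/primeP: B_prime => _ dB /dB /orP[]/eqP m1; rewrite m1 in mE.
    by apply: Or42; apply: eq_subgroup; rewrite mE mul1n.
  by apply: Or44; apply: eq_subgroup; rewrite mE /= cardsT.
rewrite Gauss_dvdr in dH; last by rewrite coprime_sym prime_coprime.
case/primeP: B_prime => _ dB; case/orP: (dB _ dH) => /eqP cH.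
  by apply: Or41; apply: eq_subgroup; rewrite cH cards1.
by apply: Or43; apply: eq_subgroup.
Qed.

(** The subgroups form the lattice of 1, [A], [B], [G], with five strict
    inclusions. *)
Lemma eq_sub_rel_lattice (T T' : sub_rel gT) :
  (forall K, T K K) -> (forall K, T' K K) ->
  (forall K H, T K H -> K \subset H) -> (forall K H, T' K H -> K \subset H) ->
  (T 1%G A <-> T' 1%G A) -> (T 1%G B <-> T' 1%G B) -> (T 1%G G <-> T' 1%G G) ->
  (T A G <-> T' A G) -> (T B G <-> T' B G) -> eq_sub_rel T T'.
Proof.
move=> rT rT' sT sT' a b c d e K H.
have A1 := prime_gt1 A_prime; have B1 := prime_gt1 B_prime.
have no (K' H' : {group gT}) : ~~ (#|K'| %| #|H'|) -> T K' H' <-> T' K' H'.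
  by move=> /negP ndv; split=> [/sT|/sT'] /cardSg.
have cG : #|G| = (#|A| * #|B|)%N by rewrite cardsT.
have dAB : ~~ (#|A| %| #|B|) by rewrite dvdn_prime2.
have dBA : ~~ (#|B| %| #|A|) by rewrite dvdn_prime2 // eq_sym.
have d1 m : 1 < m -> ~~ (m %| 1) by rewrite dvdn1 => /gtn_eqF ->.
case: (subgroup_cases K) => ->; case: (subgroup_cases H) => -> //;
  apply: no; rewrite ?cards1 ?cG ?d1 //.
- by apply: leq_trans A1 _; rewrite leq_pmulr // ltnW.
- by rewrite -[X in _ %| X]muln1 dvdn_pmul2l ?d1 // ltnW.
- by rewrite mulnC -[X in _ %| X]muln1 dvdn_pmul2l ?d1 // ltnW.
Qed.

Lemma sub1_neq (H : {group gT}) : prime #|H| -> exists2 g, g \in H & g != 1%g.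
Proof.
move=> pH; have : (H : {set gT}) != 1%g.
  by apply/eqP => H1; move: pH; rewrite H1 cards1.
by case/trivgPn => g gH g1; exists g.
Qed.

(** The character of index [#|B|] is faithful on [A] and has kernel [B]; that
    of index [#|A|] has kernel [A]; that of index 1 is faithful. *)
Section SteinerModel.
Variable I : pred nat.
Let U := cyc_rep R z_gen I.

Let ltA : #|A| < #|gT|.
Proof.
by rewrite card_G -[X in X < _]muln1 ltn_pmul2l ?prime_gt0 ?prime_gt1.
Qed.
Let ltB : #|B| < #|gT|.
Proof. by rewrite nBA -[X in X < _]muln1 ltn_pmul2l ?prime_gt0 ?prime_gt1. Qed.
Let lt1 : 1 < #|gT|. Proof. exact: leq_ltn_trans (prime_gt0 A_prime) ltA. Qed.

Lemma steiner_faithful (H : {group gT}) : I 1 -> steiner_rel U 1%G H.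
Proof.
move=> I1; apply: (@steiner_of_free_point U _ (cvec R z_gen I 1)) => h _.
by move/cvec_fixedP; rewrite mul1n dlog_eq1 => /(_ lt1 I1) /eqP.
Qed.

Lemma steiner_bottom : I #|B| -> steiner_rel U 1%G A.
Proof.
move=> IB; apply: (@steiner_of_free_point U _ (cvec R z_gen I #|B|)) => h hA.
move/cvec_fixedP; rewrite -mem_dlog => /(_ ltB IB) hB.
by apply/set1gP; rewrite -tiAB inE hA.
Qed.

Lemma steiner_top : I #|A| -> steiner_rel U A G.
Proof.
move=> IA; apply/steiner_relP; split; first exact: finset.subsetT.
exists (cvec R z_gen I #|A|) => h _; rewrite (mem_dlog z_gen).
by split=> [?|/cvec_fixedP]; [apply/cvec_fixedP | apply].
Qed.

Lemma not_steiner_bottom (H : {group gT}) : A \subset H ->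
  (forall k, I k -> k < #|gT| -> #|A| %| k) -> ~ steiner_rel U 1%G H.
Proof.
move=> sAH IA /steiner_free_point[u uH].
have [g gA /eqP g1] := sub1_neq A_prime; apply: g1; apply: uH.
  exact: (fintype.subsetP sAH).
by apply: cyc_fixed_by gA => -[[k Ik] b] _ /=; apply: IA.
Qed.

Lemma not_steiner_top :
  (forall k, I k -> k < #|gT| -> #|A| %| k -> k = 0) -> ~ steiner_rel U A G.
Proof.
move=> I0 /steiner_relP[_ [u uG]].
have [g gB /eqP g1] := sub1_neq B_prime; apply: g1; apply/set1gP.
rewrite -tiAB inE gB andbT; apply/(uG g (finset.in_setT g)).
apply/cyc_fixedP => -[[k Ik] b] uk /=.
rewrite (I0 k Ik (ltn_ord k)) //.
apply: (cyc_fixed_byP card_G _ uk) => h hA.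
exact/uG.
Qed.

End SteinerModel.

Section LinearModel.
Local Open Scope ring_scope.

Lemma cyc_actE (I : pred nat) g (u : cyc_rep R z_gen I) d :
  component (rep_act _ g u) d =
  char_cos R z_gen d.1 g *: component u d +
  ((if d.2 then 1 else -1) * char_sin R z_gen d.1 g) *:
  component u (d.1, ~~ d.2).
Proof. by rewrite /component ffunE. Qed.

Lemma char_trivial (I : pred nat) (j : {k : 'I_#|gT| | I k}) g :
  (#|gT| %| val (val j) * dlog z_gen g)%N ->
  char_cos R z_gen j g = 1 /\ char_sin R z_gen j g = 0.
Proof.
move=> nj; split; last by rewrite /char_sin tsin_eq0 // (card_gen_gt0 z_gen).
by apply/eqP; rewrite tcos_eq1 // (card_gen_gt0 z_gen).
Qed.

Lemma component_act_trivial (I : pred nat) g (u : cyc_rep R z_gen I) d :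
  (#|gT| %| val (val d.1) * dlog z_gen g)%N ->
  component (rep_act _ g u - u) d = 0.
Proof.
move=> /char_trivial[c1 s0].
rewrite /component ffunE [_ d]ffunE -/(component _ d) c1 s0.
by rewrite mulr0 scale0r addr0 scale1r [X in _ + X]ffunE subrr.
Qed.

(** On [w = y u - u] the operator [y] satisfies [y^2 = c y - 1], so that the
    first four vectors of the orbit of [u] under [y] are dependent. *)
Lemma cubic_not_free (V : orthrep R gT) (y : gT) (u : V) (c : R) :
  dot V u u = 1 ->
  (forall i, (0 < i < 4)%N -> dot V (rep_act V (y ^+ i)%g u) u = 0) ->
  let w := rep_act V y u - u in
  rep_act V y (rep_act V y w) = c *: rep_act V y w - w -> False.
Proof.
move=> u1 dX w quad; have := congr1 (fun v => dot V v u) quad.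
have yyE : rep_act V y (rep_act V y w) =
    rep_act V (y ^+ 3)%g u - rep_act V (y ^+ 2)%g u.
  by rewrite /w !linearB /= -!rep_actM !expgS expg0 mulg1 !mulgA.
have ywE : rep_act V y w = rep_act V (y ^+ 2)%g u - rep_act V (y ^+ 1)%g u.
  by rewrite /w linearB /= -rep_actM !expgS expg0 mulg1.
rewrite yyE ywE /w !linearBl /= dotZl linearBl /= !dX // u1.
by rewrite !subrr mulr0 sub0r sub0r opprK => /esym/eqP; rewrite oner_eq0.
Qed.

Lemma commutator_not_free (V : orthrep R gT) (x y : gT) (u : V) :
  dot V u u = 1 -> dot V (rep_act V x u) u = 0 -> dot V (rep_act V y u) u = 0 ->
  dot V (rep_act V (x * y)%g u) u = 0 ->
  rep_act V x (rep_act V y u - u) = rep_act V y u - u -> False.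
Proof.
move=> u1 xu yu xyu fix_x; have := congr1 (fun v => dot V v u) fix_x.
rewrite linearB /= -rep_actM !linearBl /= xu yu xyu u1 subrr sub0r => /esym/eqP.
by rewrite oppr_eq0 oner_eq0.
Qed.

(** The characters trivial on [B], which restrict to all the characters of [A],
    together with a faithful character. *)
Section OneBottom.
Hypothesis B_gt3 : (3 < #|B|)%N.
Definition bottom_index k := (#|B| %| k)%N || (k == 1%N).
Let U := cyc_rep R z_gen bottom_index.

Lemma bottom_universe : is_universe U.
Proof. by apply: cyc_rep_universe; rewrite /bottom_index dvdn0. Qed.

Lemma bottom_linisom : linisom_rel U 1%G A.
Proof.
have [j _|u uA] :=
  @cyc_free_orbit R _ _ z_gen bottom_index _ _ card_G coprime_AB.
  by rewrite /bottom_index dvdn_mull.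
exact: linisom_of_free_orbit bottom_universe _ _ uA.
Qed.

Let y := (z ^+ #|A|)%g.

Let yB : y \in B.
Proof.
by rewrite (mem_dlog z_gen) /dvdn -modnMmr dlogX modnMmr mulnC card_G modnn.
Qed.

Let yX i : (0 < i < 4)%N -> (y ^+ i)%g != 1%g.
Proof.
move=> /andP[i0 i4]; rewrite /y -expgM -order_dvdn (order_gen z_gen) card_G.
rewrite dvdn_pmul2l ?prime_gt0 //; apply/negP => /(dvdn_leq i0) leBi.
by have := leq_trans B_gt3 leBi; rewrite leqNgt i4.
Qed.

(** A generator [y] of [B] acts on [U] by the identity and by rotations of one
    angle [t], hence satisfies [(y - 1) (y^2 - 2 cos t y + 1) = 0]. As
    [#|B| > 3], this is a relation between distinct elements of a free
    orbit. *)
Lemma bottom_no_free_orbit : ~ exists u : U, free_orbit B u.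
Proof.
case=> u [u1 uB].
pose w := rep_act U y u - u.
pose c := tcos R #|gT| #|A|.
have quad : rep_act U y (rep_act U y w) = (2 * c) *: rep_act U y w - w.
  apply/ffunP => -[j b].
  rewrite [RHS]ffunE [X in _ = X + _]ffunE [X in _ = _ + X]ffunE.
  rewrite -!/(component _ (j, b)) !cyc_actE /= negbK.
  case/orP: (valP j) => [Bj|/eqP j1].
    have w0 b' : component w (j, b') = 0.
      apply: component_act_trivial => /=; have /dvdnP[k ->] := Bj.
      by rewrite -mulnA dvdn_mull // -mem_dlog.
    by rewrite !(w0, scaler0, addr0, subr0).
  have cE : char_cos R z_gen j y = c.
    have n0 := card_gen_gt0 z_gen.
    rewrite /char_cos /c [val (val j)]j1 mul1n -tcos_mod //.
    by rewrite dlogX tcos_mod.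
  have cs : char_cos R z_gen j y ^+ 2 + char_sin R z_gen j y ^+ 2 = 1.
    exact: tcos2_tsin2.
  rewrite cE in cs *; move: (char_sin R z_gen j y) cs => s cs.
  apply/polyP => i; rewrite !coefD !coefZ !coefD coefN !coefZ.
  set a := (component w (j, b))`_i; set a' := (component w (j, ~~ b))`_i.
  rewrite -[X in _ = _ - X]mul1r -[X in _ = _ - X * _]cs.
  by case: (b); rewrite /=; ring.
have dX i : (0 < i < 4)%N -> dot U (rep_act U (y ^+ i)%g u) u = 0.
  by move=> i4; apply: uB; [exact: groupX | exact: yX].
exact: (cubic_not_free u1 dX quad).
Qed.

(** Such a relation would give [B] a free orbit. *)
Lemma bottom_not_linisom (K H : {group gT}) :
  B \subset H -> B :&: K = 1%g -> ~ linisom_rel U K H.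
Proof.
move=> sBH tiBK KH; apply: bottom_no_free_orbit.
have [u [u1 _]] := free_orbit1 bottom_universe.
apply: (linisom_free_orbit KH sBH (u := u)); split=> // m.
by rewrite /= tiBK => /set1gP ->; rewrite eqxx.
Qed.

(** The characters of [U] trivial on [A] are all trivial on [B], although [B]
    acts nontrivially on [U]. *)
Lemma bottom_not_linisom_top : ~ linisom_rel U B G.
Proof.
move=> /linisom_fixed_trivial/(_ (finset.subsetT A) tiAB (abelian_G _ _)) trivB.
have I1 : bottom_index 1 by rewrite /bottom_index eqxx orbT.
have lt1 : (1 < #|gT|)%N.
  by rewrite card_G (leq_trans (prime_gt1 A_prime)) // leq_pmulr ?prime_gt0.
have [g gB /eqP g1] := sub1_neq B_prime; apply: g1.
have : rep_act U g (cvec R z_gen bottom_index 1) = cvec R z_gen bottom_index 1.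
  apply: trivB gB => u uA; apply: cyc_fixed_by => d ud.
  have Ad := cyc_fixed_byP card_G uA ud.
  case/orP: (valP d.1) => // /eqP d1; move: Ad.
  by rewrite [val (val _)]d1 dvdn1 => /eqP A1; move: A_prime; rewrite A1.
by move/cvec_fixedP; rewrite mul1n dlog_eq1 => /(_ lt1 I1)/eqP.
Qed.

End OneBottom.

(** The characters trivial on [A] or on [B]: they restrict to all the
    characters of [A], and to all those of [B]. *)
Section TwoBottoms.
Definition bottoms_index k := (#|A| %| k)%N || (#|B| %| k)%N.
Let U := cyc_rep R z_gen bottoms_index.

Lemma bottoms_universe : is_universe U.
Proof. by apply: cyc_rep_universe; rewrite /bottoms_index dvdn0. Qed.

Lemma bottoms_free_orbitA : exists u : U, free_orbit A u.
Proof.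
apply: (@cyc_free_orbit R _ _ z_gen bottoms_index _ _ card_G coprime_AB) => j _.
by rewrite /bottoms_index [X in _ || X]dvdn_mull ?orbT.
Qed.

Lemma bottoms_free_orbitB : exists u : U, free_orbit B u.
Proof.
have cBA : coprime #|B| #|A| by rewrite coprime_sym coprime_AB.
apply: (@cyc_free_orbit R _ _ z_gen bottoms_index B #|A| nBA cBA) => j _.
by rewrite /bottoms_index dvdn_mull.
Qed.

(** On each character of this universe [A] or [B] acts trivially, so that
    [(x - 1) (y - 1) = 0] on it for [x] in [A] and [y] in [B]. *)
Lemma bottoms_no_free_orbit : ~ exists u : U, free_orbit G u.
Proof.
case=> u [u1 uG].
have [x xA x1] := sub1_neq A_prime; have [y yB y1] := sub1_neq B_prime.
have xy1 : (x * y)%g != 1%g.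
  rewrite -eq_invg_mul; apply: contra x1 => /eqP xy; apply/eqP/set1gP.
  by rewrite -tiAB inE xA -groupV xy.
have inG g : g \in G by rewrite inE.
have xv : rep_act U x (rep_act U y u - u) = rep_act U y u - u.
  apply/cyc_fixedP => d vd; case/orP: (valP d.1) => /dvdnP[k kE].
    by rewrite [val (val _)]kE -mulnA dvdn_mull // -mem_dlog.
  case: vd; apply: component_act_trivial.
  by rewrite [val (val _)]kE -mulnA dvdn_mull // -mem_dlog.
exact: (commutator_not_free u1 (uG _ (inG _) x1) (uG _ (inG _) y1)
                            (uG _ (inG _) xy1) xv).
Qed.

(** Together with a free orbit of [K], such a relation would give [G] a free
    orbit. *)
Lemma bottoms_not_linisom (K : {group gT}) :
  (exists u : U, free_orbit K u) -> ~ linisom_rel U K G.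
Proof.
move=> [u uK] KG; apply: bottoms_no_free_orbit.
apply: (linisom_free_orbit KG (finset.subsetT _) (u := u)).
by apply: free_orbitS uK; rewrite finset.subsetIr.
Qed.

End TwoBottoms.

End LinearModel.

Section Impossible.
Variable U : orthrep R gT.
Hypotheses (A_le3 : #|A| = 2 \/ #|A| = 3) (U_universe : is_universe U).

Lemma mulAB_G g : exists a b, [/\ a \in A, b \in B & g = (a * b)%g].
Proof.
have AB : (A * B)%g = [set: gT]%SET.
  apply/eqP; rewrite eqEcard finset.subsetT cardsT.
  by rewrite /= TI_cardMg ?tiAB // card_G.
have : g \in (A * B)%g by rewrite AB inE.
by case/mulsgP => a b aA bB ->; exists a, b.
Qed.

Let A_trivial := forall g (u : U), g \in A -> rep_act U g u = u.

Lemma nontrivial_action : ~ A_trivial ->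
  exists g (v : U), g \in A /\ rep_act U g v <> v.
Proof.
move=> /existsNP[g /existsNP[v /not_implyP[gA gv]]].
by exists g, v.
Qed.

(** If [A] acts trivially, a point with trivial stabiliser in [B] has
    stabiliser [A] in [G = A B]. Otherwise a point moved by [A] has trivial
    stabiliser in [A], as [#|A|] is prime. *)
Lemma steiner_not_bottom : ~ eq_sub_rel (@bottom_rel gT #|B|) (steiner_rel U).
Proof.
move=> TE; have /steiner_free_point[u uB] : steiner_rel U 1%G B.
  by apply/TE; right.
have [A_triv|/nontrivial_action[g [v [gA gv]]]] := pselect A_trivial.
  have /TE[AG|[A1 _]] : steiner_rel U A G.
  - apply/steiner_relP; split; first exact: finset.subsetT.
    exists u => h _; split=> [hA|]; first exact: A_triv.
    have [a [b [aA bB ->]]] := mulAB_G h.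
    rewrite rep_actM => /(congr1 (rep_act U a^-1%g)); rewrite rep_actK.
    rewrite [X in _ = X]A_triv ?groupV // => bu.
    by rewrite (uB b bB bu) mulg1.
  - have /eqP := congr1 (fun H : {group gT} => #|H|) AG.
    rewrite /= cardsT card_G -[X in X == _]muln1 eqn_pmul2l ?prime_gt0 //.
    by move=> /eqP B1; move: B_prime; rewrite -B1.
  - by move: A_prime; rewrite A1 cards1.
have /TE[A1|[_ /eqP]] : steiner_rel U 1%G A.
- apply: (@steiner_of_free_point U _ v) => h hA hv; apply/eqP/negP => /negP h1.
  apply: gv; have hAE : <[h]>%g = A.
    apply/eqP; rewrite eqEcard cycle_subG hA /= -/(order h).
    have /(primeP A_prime).2 /orP[/eqP o1|/eqP -> //] := order_dvdG hA.
    by rewrite -order_eq1 o1 in h1.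
  move: gA; rewrite -hAE => /cycleP[i ->].
  by elim: i => [|i IHi]; rewrite ?expg0 ?rep_act1 // expgSr rep_actM hv.
- by move: A_prime; rewrite -A1 cards1.
- by rewrite (negPf neq_AB).
Qed.

(** If [A] acts trivially, the isometry that gives [1 -> B] is equivariant
    under [A], and [G] moves its image as [B] does. Otherwise [A] has a free
    orbit. *)
Lemma linisom_not_bottom : ~ eq_sub_rel (@bottom_rel gT #|B|) (linisom_rel U).
Proof.
move=> TE; have /linisom_relP[_ [f [f_iso _ f_orth]]] : linisom_rel U 1%G B.
  by apply/TE; right.
have [A_triv|/nontrivial_action[g [v [gA gv]]]] := pselect A_trivial.
  have /TE[AG|[A1 _]] : linisom_rel U A G.
  - apply/linisom_relP; split; first exact: finset.subsetT.
    exists f; split=> // [k u kA|h u v _ hA]; first by rewrite !A_triv.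
    have [a [b [aA bB hE]]] := mulAB_G h.
    rewrite hE rep_actM A_triv // f_orth //.
    by apply: contra hA => /set1gP b1; rewrite hE b1 mulg1.
  - have /eqP := congr1 (fun H : {group gT} => #|H|) AG.
    rewrite /= cardsT card_G -[X in X == _]muln1 eqn_pmul2l ?prime_gt0 //.
    by move=> /eqP B1; move: B_prime; rewrite -B1.
  - by move: A_prime; rewrite A1 cards1.
have [u uA] := small_order_free_orbit U_universe A_le3 gA gv.
have /TE[A1|[_ /eqP]] := linisom_of_free_orbit U_universe uA.
- by move: A_prime; rewrite -A1 cards1.
- by rewrite (negPf neq_AB).
Qed.

End Impossible.

Lemma bottom_not_realized :
  #|A| = 2 \/ #|A| = 3 -> ~ realized R (@bottom_rel gT #|B|).
Proof.
move=> A_le3 [U U_univ [TE|TE]]; first exact: steiner_not_bottom TE.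
exact: (linisom_not_bottom A_le3 U_univ TE).
Qed.

End TwoPrimes.

(** * Realization of transfer systems *)

Section Classification.
Variables (R : realType) (gT : finGroupType) (z : gT).
Hypothesis z_gen : <[z]>%g = [set: gT]%SET.
Variables A B : {group gT}.
Hypotheses (A_prime : prime #|A|) (B_prime : prime #|B|).
Hypotheses (neq_AB : #|A| != #|B|) (card_G : #|gT| = #|A| * #|B|).
Notation G := [set: gT]%G.

Let neq_BA : #|B| != #|A|. Proof. by rewrite eq_sym. Qed.
Let card_G' : #|gT| = #|B| * #|A|. Proof. by rewrite mulnC. Qed.

Lemma linisom_sub (U : orthrep R gT) (K H : {group gT}) :
  linisom_rel U K H -> K \subset H.
Proof. by case. Qed.

Lemma steiner_sub (U : orthrep R gT) (K H : {group gT}) :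
  steiner_rel U K H -> K \subset H.
Proof. by case. Qed.

Section OneSystem.
Variable T : sub_rel gT.
Hypothesis T_ts : transfer_system T.

Lemma ts_top_bottom (C D : {group gT}) : C :&: D = 1%g -> T C G -> T 1%G D.
Proof.
move=> tiCD /(ts_restr T_ts)/(_ (finset.subsetT D)).
by congr T; apply/val_inj.
Qed.

Lemma ts_whole_bottom (D : {group gT}) : T 1%G G -> T 1%G D.
Proof. by apply: ts_top_bottom; apply/trivgP; rewrite finset.subsetIl. Qed.

Lemma ts_bottom_top (C : {group gT}) : T 1%G C -> T C G -> T 1%G G.
Proof. exact: (ts_trans T_ts). Qed.

Definition steiner_index k :=
  [|| k == 0, `[< T 1%G G >] && (k == 1), `[< T A G >] && (k == #|A|)
    | `[< T B G >] && (k == #|B|)].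

(** The points with stabiliser [K] in [H] are read off from the kernels of the
    chosen characters. If [1 -> G] holds only because characters with kernel
    [A] and [B] both occur, then [A -> G] and [B -> G] already force it in
    [T]. *)
Lemma steiner_realized :
  (T 1%G A -> T 1%G G \/ T B G) -> (T 1%G B -> T 1%G G \/ T A G) ->
  realized R T.
Proof.
move=> hA hB; pose U := cyc_rep R z_gen steiner_index.
have I1 : T 1%G G -> steiner_index 1.
  by move=> /asboolT c; rewrite /steiner_index c.
have IA : T A G -> steiner_index #|A|.
  by move=> /asboolT c; rewrite /steiner_index c eqxx !orbT.
have IB : T B G -> steiner_index #|B|.
  by move=> /asboolT c; rewrite /steiner_index c eqxx !orbT.
have IP k : steiner_index k ->
    [\/ k = 0, T 1%G G /\ k = 1, T A G /\ k = #|A| | T B G /\ k = #|B|].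
  case/or4P=> [/eqP ->|/andP[/asboolP ? /eqP ->]|
               /andP[/asboolP ? /eqP ->]|/andP[/asboolP ? /eqP ->]].
  - exact: Or41.
  - exact: Or42.
  - exact: Or43.
  - exact: Or44.
have tiBA : B :&: A = 1%g by rewrite finset.setIC (tiAB A_prime B_prime).
have noA (H : {group gT}) :
    A \subset H -> ~ T 1%G G -> ~ T B G -> ~ steiner_rel U 1%G H.
  move=> sAH c e; apply: (not_steiner_bottom A_prime sAH) => k.
  by move=> /IP[->|[]|[_ ->]|[]].
have noB (H : {group gT}) :
    B \subset H -> ~ T 1%G G -> ~ T A G -> ~ steiner_rel U 1%G H.
  move=> sBH c d; apply: (not_steiner_bottom B_prime sBH) => k.
  by move=> /IP[->|[]|[]|[_ ->]].
exists U; first by apply: cyc_rep_universe.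
left; apply: (eq_sub_rel_lattice z_gen A_prime B_prime neq_AB card_G).
- exact: (ts_refl T_ts).
- exact: steiner_rel_refl.
- exact: (ts_sub T_ts).
- exact: steiner_sub.
- split=> [/hA[/I1 i1|/IB iB]|sA].
  + exact: (steiner_faithful R z_gen A_prime B_prime card_G).
  + exact: (steiner_bottom R z_gen A_prime B_prime neq_AB card_G iB).
  + have [c|c] := pselect (T 1%G G); first exact: ts_whole_bottom.
    have [e|e] := pselect (T B G); first exact: ts_top_bottom tiBA e.
    by case: (noA A).
- split=> [/hB[/I1 i1|/IA iA]|sB].
  + exact: (steiner_faithful R z_gen A_prime B_prime card_G).
  + exact: (steiner_bottom R z_gen B_prime A_prime neq_BA card_G' iA).
  + have [c|c] := pselect (T 1%G G); first exact: ts_whole_bottom.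
    have [d|d] := pselect (T A G).
      exact: ts_top_bottom (tiAB A_prime B_prime neq_AB) d.
    by case: (noB B).
- split=> [/I1 i1|sG].
    exact: (steiner_faithful R z_gen A_prime B_prime card_G).
  have [//|c] := pselect (T 1%G G).
  have [e|e] := pselect (T B G); last by case: (noA G (finset.subsetT _) c e).
  have [d|d] := pselect (T A G); last by case: (noB G (finset.subsetT _) c d).
  exact: ts_bottom_top (ts_top_bottom tiBA e) d.
- split=> [/IA iA|sA].
    exact: (steiner_top R z_gen A_prime B_prime card_G iA).
  have [//|d] := pselect (T A G).
  case: (not_steiner_top A_prime B_prime neq_AB card_G _ sA) => k.
  move=> /IP[//|[_ ->]|[]|[_ ->]] //.
    by rewrite dvdn1 => _ /eqP A1; move: A_prime; rewrite A1.
  by rewrite dvdn_prime2 // (negPf neq_AB).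
- split=> [/IB iB|sB].
    exact: (steiner_top R z_gen B_prime A_prime card_G' iB).
  have [//|d] := pselect (T B G).
  case: (not_steiner_top B_prime A_prime neq_BA card_G' _ sB) => k.
  move=> /IP[//|[_ ->]|[_ ->]|[]] //.
    by rewrite dvdn1 => _ /eqP B1; move: B_prime; rewrite B1.
  by rewrite dvdn_prime2 // (negPf neq_BA).
Qed.

Lemma bottoms_realized :
  T 1%G A -> T 1%G B -> ~ T 1%G G -> ~ T A G -> ~ T B G -> realized R T.
Proof.
move=> a b c d e; have univ := bottoms_universe R z_gen A B.
have [uA uAP] := bottoms_free_orbitA R z_gen A_prime B_prime neq_AB card_G.
have [uB uBP] := bottoms_free_orbitB R z_gen A_prime B_prime neq_AB card_G.
have noG (K : {group gT}) :=
  bottoms_not_linisom (K := K) A_prime B_prime neq_AB.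
exists (cyc_rep R z_gen (bottoms_index A B)) => //.
right; apply: (eq_sub_rel_lattice z_gen A_prime B_prime neq_AB card_G).
- exact: (ts_refl T_ts).
- exact: linisom_rel_refl.
- exact: (ts_sub T_ts).
- exact: linisom_sub.
- by split=> // _; exact: linisom_of_free_orbit uAP.
- by split=> // _; exact: linisom_of_free_orbit uBP.
- by split=> // /noG[]; exact: free_orbit1.
- by split=> // /noG[]; exists uA.
- by split=> // /noG[]; exists uB.
Qed.

End OneSystem.

Lemma bottom_relP (r : nat) (D : {group gT}) : D <> 1%G ->
  @bottom_rel gT r 1%G D <-> #|D| = r.
Proof. by move=> D1; split=> [[/esym //|[]//]|]; right. Qed.

Lemma bottom_rel_top (r : nat) (D : {group gT}) :
  prime #|D| -> #|D| != #|gT| -> ~ @bottom_rel gT r D G.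
Proof.
move=> D_prime /eqP DG [E|[E _]]; first by apply: DG; rewrite E cardsT.
by move: D_prime; rewrite E cards1.
Qed.

Lemma prime_neq1 (D : {group gT}) : prime #|D| -> D <> 1%G.
Proof. by move=> D_prime E; move: D_prime; rewrite E cards1. Qed.

Lemma card_propers : [/\ #|A| != #|gT|, #|B| != #|gT| & G <> 1%G].
Proof.
have A1 := prime_gt1 A_prime; have B1 := prime_gt1 B_prime.
split.
- by rewrite card_G -[X in X != _]muln1 eqn_pmul2l ?prime_gt0 // ltn_eqF.
- by rewrite card_G' -[X in X != _]muln1 eqn_pmul2l ?prime_gt0 // ltn_eqF.
- move=> E; have := congr1 (fun H : {group gT} => #|H|) E.
  rewrite /= cardsT card_G cards1 => /eqP; rewrite muln_eq1 => /andP[/eqP E1 _].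
  by rewrite E1 in A1.
Qed.

Lemma eq_bottom_rel (T : sub_rel gT) : transfer_system T ->
  T 1%G A -> ~ T 1%G B -> ~ T 1%G G -> ~ T A G -> ~ T B G ->
  eq_sub_rel T (@bottom_rel gT #|A|).
Proof.
move=> T_ts a b c d e; have B_ts := bottom_rel_transfer_system gT A_prime.
have [nA nB nG] := card_propers.
apply: (eq_sub_rel_lattice z_gen A_prime B_prime neq_AB card_G).
- exact: (ts_refl T_ts).
- exact: (ts_refl B_ts).
- exact: (ts_sub T_ts).
- exact: (ts_sub B_ts).
- by split=> // _; right.
- split=> // /(bottom_relP _ (prime_neq1 B_prime)) /eqP.
  by rewrite (negPf neq_BA).
- by split=> // /(bottom_relP _ nG) /eqP; rewrite /= cardsT eq_sym (negPf nA).
- by split=> // /bottom_rel_top; case.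
- by split=> // /bottom_rel_top; case.
Qed.

Lemma bottom_realized (T : sub_rel gT) : transfer_system T -> 3 < #|B| ->
  T 1%G A -> ~ T 1%G B -> ~ T 1%G G -> ~ T A G -> ~ T B G -> realized R T.
Proof.
move=> T_ts B_gt3 a b c d e.
have tiBA : B :&: A = 1%g by rewrite finset.setIC (tiAB A_prime B_prime).
have tiB1 : B :&: 1%G = 1%g by apply/trivgP; rewrite finset.subsetIr.
have no (K H : {group gT}) sBH tiBK :=
  bottom_not_linisom (R := R) (z_gen := z_gen) A_prime card_G B_gt3
                     (K := K) (H := H) sBH tiBK.
exists (cyc_rep R z_gen (bottom_index B)); first exact: bottom_universe.
right; apply: (eq_sub_rel_lattice z_gen A_prime B_prime neq_AB card_G).
- exact: (ts_refl T_ts).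
- exact: linisom_rel_refl.
- exact: (ts_sub T_ts).
- exact: linisom_sub.
- by split=> // _; exact: bottom_linisom.
- by split=> // /no; case.
- by split=> // /no; case=> //; exact: finset.subsetT.
- by split=> // /no; case=> //; exact: finset.subsetT.
- by split=> // /(bottom_not_linisom_top A_prime B_prime neq_AB card_G).
Qed.

End Classification.

Section Cases.
Variables (R : realType) (gT : finGroupType) (z : gT).
Hypothesis z_gen : <[z]>%g = [set: gT]%SET.
Variables A B : {group gT}.
Hypotheses (A_prime : prime #|A|) (B_prime : prime #|B|).
Hypotheses (neq_AB : #|A| != #|B|) (card_G : #|gT| = #|A| * #|B|).
Notation G := [set: gT]%G.

(** A system outside the scope of [steiner_realized] contains [1 -> A] or
    [1 -> B], and neither [1 -> G] nor the relation that would accompany it;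
    by transitivity it then contains no relation to [G] at all. *)
Lemma realized_or_bottom (T : sub_rel gT) : transfer_system T ->
  [\/ realized R T,
      eq_sub_rel T (@bottom_rel gT #|A|) /\ (3 < #|B| -> realized R T) |
      eq_sub_rel T (@bottom_rel gT #|B|) /\ (3 < #|A| -> realized R T)].
Proof.
move=> T_ts.
have neq_BA : #|B| != #|A| by rewrite eq_sym.
have card_G' : #|gT| = #|B| * #|A| by rewrite mulnC.
have tiBA : B :&: A = 1%g by rewrite finset.setIC (tiAB A_prime B_prime).
have AG_B : T A G -> T 1%G B.
  exact: ts_top_bottom (tiAB A_prime B_prime neq_AB).
have BG_A : T B G -> T 1%G A by exact: ts_top_bottom tiBA.
have A_AG := ts_bottom_top T_ts (C := A).
have B_BG := ts_bottom_top T_ts (C := B).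
have G_A := ts_whole_bottom T_ts A; have G_B := ts_whole_bottom T_ts B.
have steiner := steiner_realized R z_gen A_prime B_prime neq_AB card_G T_ts.
have [c|c] := pselect (T 1%G G).
  by apply: Or31; apply: steiner => //; left.
have [a|a] := pselect (T 1%G A); have [b|b] := pselect (T 1%G B).
- have nAG : ~ T A G by tauto.
  have nBG : ~ T B G by tauto.
  apply: Or31.
  exact: (bottoms_realized R z_gen A_prime B_prime neq_AB card_G T_ts).
- have nAG : ~ T A G by tauto.
  have [e|e] := pselect (T B G).
    by apply: Or31; apply: steiner => //; right.
  apply: Or32; split; first exact: (eq_bottom_rel z_gen A_prime B_prime).
  move=> B_gt3.
  exact: (bottom_realized R z_gen A_prime B_prime neq_AB card_G T_ts).
- have nBG : ~ T B G by tauto.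
  have [d|d] := pselect (T A G).
    by apply: Or31; apply: steiner => //; right.
  apply: Or33; split; first exact: (eq_bottom_rel z_gen B_prime A_prime).
  move=> A_gt3.
  exact: (bottom_realized R z_gen B_prime A_prime neq_BA card_G' T_ts).
- by apply: Or31; apply: steiner.
Qed.

End Cases.

Theorem corollary5p20 (R : realType) (gT : finGroupType) (p q : nat)
  (p_prime : prime p) (q_prime : prime q) (lt_pq : p < q)
  (cyclic_G : cyclic [set: gT]) (card_G : #|gT| = p * q) :
  (p = 2 /\ q = 3 ->
     (forall T : sub_rel gT, transfer_system T ->
        ~ eq_sub_rel T (@bottom_rel gT p) ->
        ~ eq_sub_rel T (@bottom_rel gT q) -> realized R T) /\
     ~ realized R (@bottom_rel gT p) /\
     ~ realized R (@bottom_rel gT q)) /\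
  ((p = 2 \/ p = 3) /\ 3 < q ->
     (forall T : sub_rel gT, transfer_system T ->
        ~ eq_sub_rel T (@bottom_rel gT q) -> realized R T) /\
     ~ realized R (@bottom_rel gT q)) /\
  (3 < p /\ 3 < q ->
     forall T : sub_rel gT, transfer_system T -> realized R T).
Proof.
have /cyclicP[z zG] := cyclic_G; have z_gen := esym zG.
have oz : #[z]%g = p * q by rewrite order_gen.
have p0 := prime_gt0 p_prime; have q0 := prime_gt0 q_prime.
pose A := <[(z ^+ q)%g]>%G; pose B := <[(z ^+ p)%g]>%G.
have cA : #|A| = p.
  by rewrite -[LHS]/(#[z ^+ q]%g) orderXdiv oz ?dvdn_mull // mulnK.
have cB : #|B| = q.
  by rewrite -[LHS]/(#[z ^+ p]%g) orderXdiv oz ?dvdn_mulr // mulKn.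
have A_prime : prime #|A| by rewrite cA.
have B_prime : prime #|B| by rewrite cB.
have neq_AB : #|A| != #|B| by rewrite cA cB ltn_eqF.
have neq_BA : #|B| != #|A| by rewrite eq_sym.
have cG : #|gT| = #|A| * #|B| by rewrite cA cB.
have cG' : #|gT| = #|B| * #|A| by rewrite mulnC.
have cases T :=
  @realized_or_bottom R gT z z_gen A B A_prime B_prime neq_AB cG T.
have no_q : p = 2 \/ p = 3 -> ~ realized R (@bottom_rel gT q).
  by rewrite -{1 2}cA -cB; exact: bottom_not_realized.
have no_p : q = 2 \/ q = 3 -> ~ realized R (@bottom_rel gT p).
  by rewrite -{1 2}cB -cA; exact: bottom_not_realized.
rewrite cA cB in cases.
split; [move=> [p2 q3]|split; [move=> [p23 q_gt3]|move=> [p_gt3 q_gt3] T T_ts]].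
- split; last by split; [apply: no_p; right | apply: no_q; left].
  by move=> T T_ts nTp nTq; case: (cases T T_ts) => [//|[]|[]].
- split; last exact: no_q.
  by move=> T T_ts nTq; case: (cases T T_ts) => [//|[_]|[]//]; apply.
- by case: (cases T T_ts) => [//|[_]|[_]]; apply.
Qed.
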